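(* Let $V$ be the $\mathbb{Q}$-vector space of multilinear ternary polynomials of degree 7 in the variables $a,b,c,d,e,f,g$. Let $V_{\mathrm{PATS}}\subseteq V$ be the subspace of those $f$ such that $f\equiv 0$ is satisfied by the partially alternating ternary sum, and let $V_{P,Q}\subseteq V_{\mathrm{PATS}}$ be the subspace of those $f$ such that $f\equiv0$ is a consequence of the identities $P(a,b,c)=(a,b,c)+(a,c,b)\equiv 0$ and $Q(a,b,c,d,e)=(a,(b,c,d),e)+(a,(c,b,d),e)\equiv 0$. Then $\dim\left(V_{\mathrm{PATS}}/V_{P,Q}\right)=49$.
   Context: The base field is $\mathbb{Q}$. An (associative) dialgebra is a vector space $A$ with two bilinear products $\dashv,\vdash$ satisfying $(a\dashv b)\dashv c=a\dashv(b\dashv c)$, $(a\vdash b)\vdash c=a\vdash(b\vdash c)$, $(a\vdash b)\dashv c=a\vdash(b\dashv c)$, $(a\dashv b)\vdash c=(a\vdash b)\vdash c$, $a\dashv(b\dashv c)=a\dashv(b\vdash c)$. The partially alternating ternary sum (PATS) is the trilinear operation on a dialgebra $$[a,b,c]=a\dashv b\dashv c-a\dashv c\dashv b-b\vdash a\dashv c+c\vdash a\dashv b+b\vdash c\vdash a-c\vdash b\vdash a .$$ A ternary algebra is a vector space with a trilinear product $(\cdot,\cdot,\cdot)$. A (ternary) polynomial of degree $n$ is a linear combination of monomials of degree $n$ in the free (nonassociative) ternary algebra on a set of variables; it is multilinear if each of $n$ variables occurs exactly once in each monomial. A polynomial identity $f\equiv 0$ is satisfied by the PATS if $f$ vanishes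 for all values of the variables in every dialgebra when $(\cdot,\cdot,\cdot)$ is interpreted as the PATS. An identity is a consequence of a set of identities if it holds in every ternary algebra over $\mathbb{Q}$ satisfying all the identities of that set. *)

(* Defs.v *)
From HB Require Import structures.
From mathcomp Require Import all_boot all_order all_algebra.

Set Implicit Arguments.
Unset Strict Implicit.
Unset Printing Implicit Defensive.

Import GRing.Theory.
Local Open Scope ring_scope.

Definition trilinear (A : lmodType rat) (op : A -> A -> A -> A) : Prop :=
  [/\ forall b c, linear (fun a => op a b c),
      forall a c, linear (fun b => op a b c)
    & forall a b, linear (fun c => op a b c)].

Record ternaryAlgebra := TernaryAlgebra {
  ta_space :> lmodType rat;
  ta_op : ta_space -> ta_space -> ta_space -> ta_space;
  ta_opP : trilinear ta_op }.

(* [da_l a b] is a -| b and [da_r a b] is a |- b. *)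
Record dialgebra := Dialgebra {
  da_space :> lmodType rat;
  da_l : da_space -> da_space -> da_space;
  da_r : da_space -> da_space -> da_space;
  da_l_linearl : forall b, linear (fun a => da_l a b);
  da_l_linearr : forall a, linear (fun b => da_l a b);
  da_r_linearl : forall b, linear (fun a => da_r a b);
  da_r_linearr : forall a, linear (fun b => da_r a b);
  da_llA : forall a b c, da_l (da_l a b) c = da_l a (da_l b c);
  da_rrA : forall a b c, da_r (da_r a b) c = da_r a (da_r b c);
  da_rlA : forall a b c, da_l (da_r a b) c = da_r a (da_l b c);
  da_barl : forall a b c, da_r (da_l a b) c = da_r (da_r a b) c;
  da_barr : forall a b c, da_l a (da_l b c) = da_l a (da_r b c) }.

Section PATS.
Variable D : dialgebra.
Local Notation "a -| b" := (@da_l D a b) (at level 40, left associativity).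
Local Notation "a |- b" := (@da_r D a b) (at level 40, left associativity).

Definition pats (a b c : D) : D :=
  a -| b -| c - a -| c -| b - b |- a -| c + c |- a -| b
  + b |- c |- a - c |- b |- a.

Lemma pats_trilinear : trilinear pats.
Proof.
have lD b (x y : D) k : (k *: x + y) -| b = k *: (x -| b) + (y -| b).
  exact: (da_l_linearl b k x y).
have Dl b (x y : D) k : b -| (k *: x + y) = k *: (b -| x) + (b -| y).
  exact: (da_l_linearr b k x y).
have rD b (x y : D) k : (k *: x + y) |- b = k *: (x |- b) + (y |- b).
  exact: (da_r_linearl b k x y).
have Dr b (x y : D) k : b |- (k *: x + y) = k *: (b |- x) + (b |- y).
  exact: (da_r_linearr b k x y).
have cmb (k : rat) (x1 x2 y1 y2 : D) :
  (k *: x1 + y1) + (k *: x2 + y2) = k *: (x1 + x2) + (y1 + y2).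
  by rewrite scalerDr addrACA.
have opp (k : rat) (x y : D) : - (k *: x + y) = k *: (- x) + (- y).
  by rewrite opprD scalerN.
by split=> u v k x y; rewrite /pats !(lD, Dl, rD, Dr) !opp !cmb.
Qed.

Definition pats_algebra : ternaryAlgebra := TernaryAlgebra pats_trilinear.

End PATS.

(* Monomials of the free ternary algebra on variables x_0, x_1, x_2, ... *)
Inductive tmon : Type :=
| TVar of nat
| TProd of tmon & tmon & tmon.

Fixpoint tleaves (t : tmon) : seq nat :=
  match t with
  | TVar i => [:: i]
  | TProd t1 t2 t3 => tleaves t1 ++ tleaves t2 ++ tleaves t3
  end.

Definition multilinear (n : nat) (t : tmon) : bool :=
  perm_eq (tleaves t) (iota 0 n).

Fixpoint tmon_code (t : tmon) : GenTree.tree nat :=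
  match t with
  | TVar i => GenTree.Leaf i
  | TProd t1 t2 t3 =>
      GenTree.Node 0 [:: tmon_code t1; tmon_code t2; tmon_code t3]
  end.

Fixpoint tmon_decode (c : GenTree.tree nat) : option tmon :=
  match c with
  | GenTree.Leaf i => Some (TVar i)
  | GenTree.Node _ [:: c1; c2; c3] =>
      match tmon_decode c1, tmon_decode c2, tmon_decode c3 with
      | Some t1, Some t2, Some t3 => Some (TProd t1 t2 t3)
      | _, _, _ => None
      end
  | _ => None
  end.

Lemma tmon_codeK : pcancel tmon_code tmon_decode.
Proof. by elim=> //= t1 -> t2 -> t3 ->. Qed.

HB.instance Definition _ := Countable.copy tmon (pcan_type tmon_codeK).

Record mlmon (n : nat) := MlMon {
  mlmon_val :> tmon;
  mlmon_valP : multilinear n mlmon_val }.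

HB.instance Definition _ n := [isSub for @mlmon_val n].
HB.instance Definition _ n := [Countable of mlmon n by <:].

(* Finiteness of [mlmon n]: a tree with n leaves has height less than n. *)
Fixpoint tmon_upto (n h : nat) : seq tmon :=
  [seq TVar i | i <- iota 0 n] ++
  (if h is h'.+1 then
     [seq TProd p.1.1 p.1.2 p.2
     | p <- [seq (q, t) | q <- [seq (t1, t2) | t1 <- tmon_upto n h',
                                               t2 <- tmon_upto n h'],
                          t <- tmon_upto n h']]
   else [::]).

Lemma size_tleaves_gt0 t : (0 < size (tleaves t))%N.
Proof. by elim: t => //= t1 IH1 t2 _ t3 _; rewrite size_cat addn_gt0 IH1. Qed.

Lemma mem_tmon_upto n h t : (size (tleaves t) <= h.+1)%N ->
  {subset tleaves t <= iota 0 n} -> t \in tmon_upto n h.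
Proof.
elim: h t => [|h IHh] [i|t1 t2 t3] /= szt sub_t; rewrite mem_cat.
- by rewrite map_f // sub_t ?mem_head.
- move: szt; rewrite !size_cat.
  move: (size_tleaves_gt0 t1) (size_tleaves_gt0 t2).
  by case: (size (tleaves t1)) => [|[|?]]; case: (size (tleaves t2)).
- by rewrite map_f // sub_t ?mem_head.
apply/orP; right; apply/mapP; exists ((t1, t2), t3) => //=.
have g1 := size_tleaves_gt0 t1; have g2 := size_tleaves_gt0 t2.
have g3 := size_tleaves_gt0 t3; rewrite !size_cat in szt.
apply/allpairsP; exists ((t1, t2), t3); split=> //=.
  apply/allpairsP; exists (t1, t2); split=> //=; apply: IHh.
  - rewrite -ltnS; apply: leq_trans szt.
    by rewrite -[X in (X < _)%N]addn0 ltn_add2l addn_gt0 g2.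
  - by move=> i it; apply: sub_t; rewrite mem_cat it.
  - rewrite -ltnS; apply: leq_trans szt.
    by rewrite -[X in (X < _)%N]add0n -addSn leq_add // leq_addr.
  - by move=> i it; apply: sub_t; rewrite !mem_cat it orbT.
apply: IHh.
- rewrite -ltnS; apply: leq_trans szt.
  by rewrite addnA -[X in (X < _)%N]add0n ltn_add2r addn_gt0 g1.
- by move=> i it; apply: sub_t; rewrite !mem_cat it !orbT.
Qed.

Definition mlmon_enum n : seq (mlmon n) := undup (pmap insub (tmon_upto n n)).

Lemma mlmon_enumP n : Finite.axiom (mlmon_enum n).
Proof.
apply: Finite.uniq_enumP; first exact: undup_uniq.
move=> m; rewrite mem_undup mem_pmap_sub inE mem_tmon_upto //.
  by rewrite (perm_size (valP m)) size_iota.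
by move=> i; rewrite (perm_mem (valP m)).
Qed.

HB.instance Definition _ n := isFinite.Build (mlmon n) (@mlmon_enumP n).

(* A multilinear ternary polynomial of degree n in x_0, ..., x_(n-1) is given by
   its coefficients on the multilinear monomials. *)
Definition mlpoly (n : nat) : vectType rat := {ffun mlmon n -> rat^o}.

Definition mlmonomial n (t : tmon) (t_ml : multilinear n t) : mlpoly n :=
  [ffun m => (m == MlMon t_ml)%:R].

Fixpoint tmon_eval (A : ternaryAlgebra) (v : nat -> A) (t : tmon) : A :=
  match t with
  | TVar i => v i
  | TProd t1 t2 t3 =>
      ta_op (tmon_eval v t1) (tmon_eval v t2) (tmon_eval v t3)
  end.

Definition mlpoly_eval (A : ternaryAlgebra) (v : nat -> A) n (f : mlpoly n) : A :=
  \sum_(m : mlmon n) (f m : rat) *: tmon_eval v m.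

Definition satisfies (A : ternaryAlgebra) n (f : mlpoly n) : Prop :=
  forall v : nat -> A, mlpoly_eval v f = 0.

Definition satisfied_by_PATS n (f : mlpoly n) : Prop :=
  forall D : dialgebra, satisfies (pats_algebra D) f.

(* P(a,b,c) = (a,b,c) + (a,c,b) with a, b, c = x_0, x_1, x_2. *)
Definition P_ident : mlpoly 3 :=
  mlmonomial (n := 3) (t := TProd (TVar 0) (TVar 1) (TVar 2)) isT
  + mlmonomial (n := 3) (t := TProd (TVar 0) (TVar 2) (TVar 1)) isT.

(* Q(a,b,c,d,e) = (a,(b,c,d),e) + (a,(c,b,d),e) with a, ..., e = x_0, ..., x_4. *)
Definition Q_ident : mlpoly 5 :=
  mlmonomial (n := 5)
    (t := TProd (TVar 0) (TProd (TVar 1) (TVar 2) (TVar 3)) (TVar 4)) isT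
  + mlmonomial (n := 5)
    (t := TProd (TVar 0) (TProd (TVar 2) (TVar 1) (TVar 3)) (TVar 4)) isT.

Definition consequence_of_PQ n (f : mlpoly n) : Prop :=
  forall A : ternaryAlgebra,
    satisfies A P_ident -> satisfies A Q_ident -> satisfies A f.

Lemma mlpoly_evalD (A : ternaryAlgebra) (v : nat -> A) n (f g : mlpoly n) :
  mlpoly_eval v (f + g) = mlpoly_eval v f + mlpoly_eval v g.
Proof.
by rewrite -big_split; apply: eq_bigr => m _; rewrite ffunE scalerDl.
Qed.

Lemma mlpoly_eval_monomial (A : ternaryAlgebra) (v : nat -> A) n t
    (t_ml : multilinear n t) :
  mlpoly_eval v (mlmonomial t_ml) = tmon_eval v t.
Proof.
rewrite /mlpoly_eval (bigD1 (MlMon t_ml)) //= ffunE eqxx scale1r.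
by rewrite big1 ?addr0 // => m /negPf m_neq; rewrite ffunE m_neq scale0r.
Qed.

Lemma satisfies_P (A : ternaryAlgebra) : satisfies A P_ident <->
  forall a b c : A, ta_op a b c + ta_op a c b = 0.
Proof.
split=> [AP a b c | AP v]; last first.
  by rewrite mlpoly_evalD !mlpoly_eval_monomial /= AP.
by have := AP (nth 0 [:: a; b; c]); rewrite mlpoly_evalD !mlpoly_eval_monomial.
Qed.

Lemma satisfies_Q (A : ternaryAlgebra) : satisfies A Q_ident <->
  forall a b c d e : A,
    ta_op a (ta_op b c d) e + ta_op a (ta_op c b d) e = 0.
Proof.
split=> [AQ a b c d e | AQ v]; last first.
  by rewrite mlpoly_evalD !mlpoly_eval_monomial /= AQ.
have := AQ (nth 0 [:: a; b; c; d; e]).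
by rewrite mlpoly_evalD !mlpoly_eval_monomial.
Qed.

(* Main.v *)
Require Import Defs.
From mathcomp Require Import all_boot all_order all_algebra.
From HB Require Import structures.
From mathcomp Require Import ring lra zify.

(* Modulo P and Q a monomial is determined by its leftmost leaf (the center)
   and by its class in the free alternating ternary algebra: all products other
   than those along the path to the center become alternating.  The PATS is the
   alternating ternary sum with the same center, so f holds for it iff, for each
   center c, the coordinates [phi f c] of f on the alternating classes are
   annihilated by expansion into associative words.  The word w receives the
   coordinates of the twelve planar ternary trees with leaf word w; after
   twisting by the sign of the leaf word, the coordinates are functions
   Z({abc},{def}|g) and F({abc},{de},{fg}) of the classes [[abc][def]g] and
   [[[abc]de]fg] whose sum over these twelve trees vanishes for every w.  The
   solutions are
     Z = h_g,  F = (- (h_a + h_b + h_c) + 2 (h_d + h_e) - (h_f + h_g)) / 3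
   with h arbitrary on the seven letters.  That there are no others follows from
   two explicit combinations of the equations, one showing that Z only depends
   on g and one showing that F vanishes if Z does.  Hence dimension 7 for each
   of the seven centers. *)

Set Implicit Arguments.
Unset Strict Implicit.
Unset Printing Implicit Defensive.

Import Order.TTheory GRing.Theory Num.Theory.
Local Open Scope ring_scope.

(** * Alternating equivalence of ternary trees *)

(** The terms come in the order of those of the PATS. *)
Definition alt3 (T : Type) (V : zmodType) (g : T -> T -> T -> V) x y z : V :=
  g x y z - g x z y - g y x z + g z x y + g y z x - g z y x.

Fixpoint center (t : tmon) : nat :=
  match t with TVar i => i | TProd t1 _ _ => center t1 end.

Fixpoint tmap (r : nat -> nat) (t : tmon) : tmon :=
  match t with
  | TVar i => TVar (r i)
  | TProd t1 t2 t3 => TProd (tmap r t1) (tmap r t2) (tmap r t3)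
  end.

(* The coefficient of u in t when all products are made alternating. *)
Fixpoint acoef (t u : tmon) : rat :=
  match t, u with
  | TVar i, TVar j => (i == j)%:R
  | TProd t1 t2 t3, TProd u1 u2 u3 =>
      alt3 (fun x y z => acoef t1 x * acoef t2 y * acoef t3 z) u1 u2 u3
  | _, _ => 0
  end.

(* u is obtained from t by permuting children, k being the total sign. *)
Inductive tequiv : rat -> tmon -> tmon -> Prop :=
| TeqVar i : tequiv 1 (TVar i) (TVar i)
| TeqProd k1 k2 k3 t1 t2 t3 u1 u2 u3 :
    tequiv k1 t1 u1 -> tequiv k2 t2 u2 -> tequiv k3 t3 u3 ->
    tequiv (k1 * k2 * k3) (TProd t1 t2 t3) (TProd u1 u2 u3)
| TeqSwap12 k t u1 u2 u3 :
    tequiv k t (TProd u1 u2 u3) -> tequiv (- k) t (TProd u2 u1 u3)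
| TeqSwap23 k t u1 u2 u3 :
    tequiv k t (TProd u1 u2 u3) -> tequiv (- k) t (TProd u1 u3 u2).

Lemma acoef_sym t u : acoef t u = acoef u t.
Proof.
elim: t u => [i|t1 IH1 t2 IH2 t3 IH3] [j|u1 u2 u3] //=; first by rewrite eq_sym.
by rewrite /alt3 !(IH1, IH2, IH3); ring.
Qed.

Lemma acoef_neq0 t u : acoef t u != 0 -> exists k, tequiv k t u.
Proof.
elim: t u => [i|t1 IH1 t2 IH2 t3 IH3] [j|u1 u2 u3] //=.
  by case: (i =P j) => [->|] //; exists 1; constructor.
have key x y z : acoef t1 x * acoef t2 y * acoef t3 z != 0 ->
    exists k, tequiv k (TProd t1 t2 t3) (TProd x y z).
  rewrite !mulf_eq0 !negb_or -andbA.
  case/and3P=> /IH1[k1 h1] /IH2[k2 h2] /IH3[k3 h3].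
  by exists (k1 * k2 * k3); constructor.
rewrite /alt3.
case: (boolP (acoef t1 u1 * acoef t2 u2 * acoef t3 u3 == 0)) => [/eqP ->|/key //].
case: (boolP (acoef t1 u1 * acoef t2 u3 * acoef t3 u2 == 0)) => [/eqP ->|/key[k h] _]; last first.
  by exists (- k); apply: TeqSwap23.
case: (boolP (acoef t1 u2 * acoef t2 u1 * acoef t3 u3 == 0)) => [/eqP ->|/key[k h] _]; last first.
  by exists (- k); apply: TeqSwap12.
case: (boolP (acoef t1 u3 * acoef t2 u1 * acoef t3 u2 == 0)) => [/eqP ->|/key[k h] _]; last first.
  by exists (- - k); apply/TeqSwap23/TeqSwap12.
case: (boolP (acoef t1 u2 * acoef t2 u3 * acoef t3 u1 == 0)) => [/eqP ->|/key[k h] _]; last first.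
  by exists (- - k); apply/TeqSwap12/TeqSwap23.
case: (boolP (acoef t1 u3 * acoef t2 u2 * acoef t3 u1 == 0)) => [/eqP ->|/key[k h] _]; last first.
  by exists (- - - k); apply/TeqSwap23/TeqSwap12/TeqSwap23.
by rewrite !(subr0, addr0) eqxx.
Qed.

Lemma tequiv_sq k t u : tequiv k t u -> k * k = 1.
Proof.
elim=> [i|k1 k2 k3 t1 t2 t3 u1 u2 u3 _ h1 _ h2 _ h3|k' t' u1 u2 u3 _ h
  |k' t' u1 u2 u3 _ h]; rewrite ?mulr1 ?mulrNN //.
by rewrite mulrACA [k1 * k2 * _]mulrACA h1 h2 h3 !mulr1.
Qed.

Lemma tequiv_neq0 k t u : tequiv k t u -> k != 0.
Proof.
by move=> /tequiv_sq kk; apply/eqP=> k0; move: kk; rewrite k0 mul0r => /eqP.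
Qed.

Lemma acoef_swap12 w x y z :
  acoef (TProd y x z) w = - acoef (TProd x y z) w.
Proof. by case: w => [i|w1 w2 w3] /=; rewrite ?oppr0 // /alt3; ring. Qed.

Lemma acoef_swap23 w x y z :
  acoef (TProd x z y) w = - acoef (TProd x y z) w.
Proof. by case: w => [i|w1 w2 w3] /=; rewrite ?oppr0 // /alt3; ring. Qed.

Lemma tequiv_acoefl k t u w : tequiv k t u -> acoef t w = k * acoef u w.
Proof.
move=> h; elim: h w => {k t u} [i|k1 k2 k3 t1 t2 t3 u1 u2 u3 _ h1 _ h2 _ h3|k t u1 u2 u3 _ h
  |k t u1 u2 u3 _ h] w.
- by rewrite mul1r.
- case: w => [i|w1 w2 w3] /=; rewrite ?mulr0 // /alt3 !(h1, h2, h3); ring.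
- by rewrite acoef_swap12 h mulrNN.
- by rewrite acoef_swap23 h mulrNN.
Qed.

Lemma tequiv_acoefr k t u w : tequiv k t u -> acoef w t = k * acoef w u.
Proof. by rewrite ![acoef w _]acoef_sym; apply: tequiv_acoefl. Qed.

Lemma tequiv_refl t : tequiv 1 t t.
Proof.
elim: t => [i|t1 h1 t2 h2 t3 h3]; first by constructor.
by have := TeqProd h1 h2 h3; rewrite !mulr1.
Qed.

Lemma tequiv_perm k t u : tequiv k t u -> perm_eq (tleaves t) (tleaves u).
Proof.
elim=> {k t u} [i|k1 k2 k3 t1 t2 t3 u1 u2 u3 _ h1 _ h2 _ h3|k t u1 u2 u3 _ h
  |k t u1 u2 u3 _ h] //=.
- by rewrite !perm_cat.
- by apply: (perm_trans h); rewrite /= perm_catCA.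
- by apply: (perm_trans h); rewrite /= perm_cat2l perm_catC.
Qed.

Lemma tequiv_tmap r k t u : tequiv k t u -> tequiv k (tmap r t) (tmap r u).
Proof. by elim=> *; constructor. Qed.

Lemma center_leaves t : center t \in tleaves t.
Proof. by elim: t => [i|t1 h1 t2 _ t3 _] /=; rewrite ?mem_head // mem_cat h1. Qed.

Lemma acoef_disj t u i : i \in tleaves t -> i \notin tleaves u -> acoef t u = 0.
Proof.
move=> it iu; apply: contraTeq it => /acoef_neq0[k /tequiv_perm/perm_mem ->].
exact: iu.
Qed.

Lemma uniq_cat3 (a b c : seq nat) : uniq (a ++ b ++ c) ->
  [/\ uniq a, uniq b & uniq c] /\
  [/\ forall i, i \in a -> i \notin b, forall i, i \in a -> i \notin c
    & forall i, i \in b -> i \notin c].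
Proof.
rewrite !cat_uniq has_cat negb_or => /and3P[ua /andP[ab ac] /and3P[ub bc uc]].
split; split=> // i; apply: contraTN => ix.
- by apply: contra ab => ia; apply/hasP; exists i.
- by apply: contra ac => ia; apply/hasP; exists i.
- by apply: contra bc => ia; apply/hasP; exists i.
Qed.

(** Distinct leaves give the three children disjoint leaf sets, so of the six terms only the one of
    the identity permutation survives. *)
Lemma acoef_refl t : uniq (tleaves t) -> acoef t t = 1.
Proof.
elim: t => [i|t1 IH1 t2 IH2 t3 IH3] /=; first by rewrite eqxx.
move=> /uniq_cat3[[u1 u2 u3] [d12 d13 d23]]; rewrite /alt3 IH1 // IH2 // IH3 //.
have c1 := center_leaves t1; have c2 := center_leaves t2.
rewrite (acoef_disj c1 (d12 _ c1)) (acoef_disj c1 (d13 _ c1)).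
rewrite (acoef_disj c2 (d23 _ c2)); ring.
Qed.

(** Since [acoef u u] is 1, a nonzero coefficient is itself the sign of the equivalence. *)
Lemma acoef_tequiv t u : uniq (tleaves u) -> acoef t u != 0 ->
  tequiv (acoef t u) t u.
Proof.
move=> uu /acoef_neq0[k h].
by rewrite (tequiv_acoefl u h) acoef_refl // mulr1.
Qed.

(** * Signs of leaf words *)

Definition sg (i j : nat) : rat := if (i < j)%N then 1 else - 1.

Definition cross (a b : seq nat) : rat := \prod_(i <- a) \prod_(j <- b) sg i j.

(* The sign of the permutation sorting w, for w without repetition. *)
Fixpoint wsgn (w : seq nat) : rat :=
  if w is i :: w' then (\prod_(j <- w') sg i j) * wsgn w' else 1.

Lemma sg_sq i j : sg i j * sg i j = 1.
Proof. by rewrite /sg; case: ifP => _; rewrite ?mulrNN mulr1. Qed.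

Lemma wsgn_sq w : wsgn w * wsgn w = 1.
Proof.
elim: w => [|i w IH] /=; first by rewrite mulr1.
rewrite mulrACA IH mulr1 -big_split big1 // => j _; exact: sg_sq.
Qed.

Lemma wsgn_cat a b : wsgn (a ++ b) = wsgn a * wsgn b * cross a b.
Proof.
rewrite /cross; elim: a => [|i a IH] /=; first by rewrite big_nil mul1r mulr1.
by rewrite big_cons big_cat IH /=; ring.
Qed.

Lemma cross_catr a b c : cross a (b ++ c) = cross a b * cross a c.
Proof.
by rewrite /cross -big_split; apply: eq_bigr => i _; rewrite big_cat.
Qed.

Lemma cross_perm a b a' b' : perm_eq a a' -> perm_eq b b' ->
  cross a b = cross a' b'.
Proof.
move=> pa pb; rewrite /cross (perm_big _ pa) /=.
by apply: eq_bigr => i _; rewrite (perm_big _ pb).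
Qed.

Lemma crossC a b : (forall i, i \in a -> i \notin b) ->
  cross b a = (-1) ^+ (size a * size b) * cross a b.
Proof.
move=> dab; rewrite /cross exchange_big /=.
rewrite (eq_big_seq (fun i => (-1) ^+ size b * \prod_(j <- b) sg i j)).
  rewrite big_split /= big_const_seq count_predT mulnC exprM; congr (_ * _).
  by rewrite iter_mulr_1.
move=> i ia; rewrite -[(-1) ^+ size b](iter_mulr_1) -[size b]count_predT.
rewrite -big_const_seq -big_split; apply: eq_big_seq => j jb.
have ij : i != j by apply: contraNneq (dab _ ia) => ->.
rewrite /sg; case: (ltngtP i j) => [_|_|e] /=; [ring|ring|by rewrite e eqxx in ij].
Qed.

Lemma size_tleaves_odd t : odd (size (tleaves t)).
Proof. by elim: t => //= t1 h1 t2 h2 t3 h3; rewrite !size_cat !oddD h1 h2 h3. Qed.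

Lemma crossC_odd a b : odd (size a) -> odd (size b) ->
  (forall i, i \in a -> i \notin b) -> cross b a = - cross a b.
Proof.
by move=> oa ob /crossC ->; rewrite -signr_odd oddM oa ob expr1 mulN1r.
Qed.

(** Every subtree has an odd number of leaves, so exchanging two siblings reverses the sign of the
    leaf word, just as it reverses the sign of the tree. Multiplying by [wsgn] therefore turns
    alternating functions of trees into invariant ones. *)
Lemma tequiv_wsgn k t u : tequiv k t u -> uniq (tleaves u) ->
  wsgn (tleaves t) = k * wsgn (tleaves u).
Proof.
elim=> {k t u} [i _|k1 k2 k3 t1 t2 t3 u1 u2 u3 e1 h1 e2 h2 e3 h3
  |k t u1 u2 u3 _ h|k t u1 u2 u3 _ h] /=.
- by rewrite mul1r.
- move=> /uniq_cat3[[U1 U2 U3] _]; rewrite !wsgn_cat !cross_catr h1 // h2 // h3 //.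
  have p1 := tequiv_perm e1; have p2 := tequiv_perm e2; have p3 := tequiv_perm e3.
  rewrite (cross_perm p1 p2) (cross_perm p1 p3) (cross_perm p2 p3); ring.
- move=> U; have /uniq_cat3[_ [d21 _ _]] := U.
  rewrite h /= ?(uniq_catCA (tleaves u1)) //.
  rewrite !wsgn_cat !cross_catr.
  rewrite (crossC_odd _ _ d21) ?size_tleaves_odd //; ring.
- move=> U; have /uniq_cat3[_ [_ _ d32]] := U.
  have U' : uniq (tleaves u1 ++ tleaves u2 ++ tleaves u3).
    by rewrite (perm_uniq (s2 := tleaves u1 ++ tleaves u3 ++ tleaves u2)) //
       perm_cat2l perm_catC.
  rewrite h //= !wsgn_cat !cross_catr.
  rewrite (crossC_odd _ _ d32) ?size_tleaves_odd //; ring.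
Qed.

(** * Consequences of P and Q *)

Definition phi n (f : mlpoly n) (c : nat) (u : tmon) : rat :=
  \sum_(m : mlmon n | center m == c) (f m : rat) * acoef m u.

Lemma mlmon_uniq n (m : mlmon n) : uniq (tleaves m).
Proof. by rewrite (perm_uniq (valP m)) iota_uniq. Qed.

Lemma lin0 (U V : lmodType rat) (f : U -> V) : linear f -> f 0 = 0.
Proof. by move=> /(_ (-1) 0 0); rewrite !scaleN1r oppr0 addr0 addNr. Qed.

Lemma linZ (U V : lmodType rat) (f : U -> V) : linear f ->
  forall k x, f (k *: x) = k *: f x.
Proof. by move=> lf k x; have := lf k x 0; rewrite (lin0 lf) !addr0. Qed.

Lemma linD (U V : lmodType rat) (f : U -> V) : linear f ->
  forall x y, f (x + y) = f x + f y.
Proof. by move=> lf x y; have := lf 1 x y; rewrite !scale1r. Qed.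

Section TestAlgebra.
Variable s : seq tmon.

(** Values are recorded on a finite list of trees only. As products look no further than the
    children of a tree, a list closed under subterms suffices to compute the coefficient at one
    tree. *)
Definition tfun : lmodType rat := {ffun seq_sub s -> rat^o}.

Definition tval (f : tfun) (t : tmon) : rat :=
  if insub t is Some u then f u else 0.

Lemma tvalP k (f g : tfun) t : tval (k *: f + g) t = k * tval f t + tval g t.
Proof.
by rewrite /tval; case: insub => [u|]; rewrite ?ffunE ?mulr0 ?addr0.
Qed.

(* The product dual to cutting trees at the root: evaluating a monomial in it
   computes [acoef]. *)
Definition talt (f g h : tfun) : tfun :=
  [ffun u => if val u is TProd x y z
             then alt3 (fun x y z => tval f x * tval g y * tval h z) x y z
             else 0].

Lemma tval_talt f g h x y z : TProd x y z \in s ->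
  tval (talt f g h) (TProd x y z) =
  alt3 (fun x y z => tval f x * tval g y * tval h z) x y z.
Proof. by move=> us; rewrite {1}/tval insubT ffunE. Qed.

Lemma talt_swap23 f g h : talt f h g = - talt f g h.
Proof.
apply/ffunP=> u; rewrite !ffunE; case: (val u) => [i|x y z]; rewrite ?oppr0 //.
by rewrite /alt3; ring.
Qed.

Lemma talt_swap12 f g h : talt g f h = - talt f g h.
Proof.
apply/ffunP=> u; rewrite !ffunE; case: (val u) => [i|x y z]; rewrite ?oppr0 //.
by rewrite /alt3; ring.
Qed.

Lemma talt_lin1 k f f' g h :
  talt (k *: f + f') g h = k *: talt f g h + talt f' g h.
Proof.
apply/ffunP=> u; rewrite !ffunE; case: (val u) => [i|x y z].
  by rewrite scaler0 addr0.
by rewrite /alt3 !tvalP /GRing.scale /=; ring.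
Qed.

Lemma talt_lin2 k f f' g h :
  talt g (k *: f + f') h = k *: talt g f h + talt g f' h.
Proof. by rewrite !(talt_swap12 _ g) talt_lin1 opprD scalerN. Qed.

Lemma talt_lin3 k f f' g h :
  talt g h (k *: f + f') = k *: talt g h f + talt g h f'.
Proof. by rewrite !(talt_swap23 g _ h) talt_lin2 opprD scalerN. Qed.

(* The second component is the value in the alternating algebra, the first one
   the part of it with the center under consideration. *)
Definition tdi_op (x y z : (tfun * tfun)%type) : (tfun * tfun)%type :=
  (talt x.1 y.2 z.2, talt x.2 y.2 z.2).

Lemma tdi_trilinear : trilinear tdi_op.
Proof.
split=> u v k x y; rewrite /tdi_op /=.
- by rewrite !talt_lin1.
- by rewrite !talt_lin2.
- by rewrite !talt_lin3.
Qed.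

Definition tdi_algebra : ternaryAlgebra := TernaryAlgebra tdi_trilinear.

(** The last two arguments enter through their alternating components only; this yields both P and
    Q. *)
Lemma tdi_P : satisfies tdi_algebra P_ident.
Proof.
apply/satisfies_P => a b c.
by apply: injective_projections => /=; rewrite talt_swap23 addNr.
Qed.

Lemma tdi_Q : satisfies tdi_algebra Q_ident.
Proof.
apply/satisfies_Q => a b c d e.
have tN f g h : talt f (- g) h = - talt f g h.
  by rewrite -!scaleN1r (linZ (fun k g g' => talt_lin2 k g g' f h)).
by apply: injective_projections; rewrite /= (talt_swap12 b.2) tN subrr.
Qed.

(** The first component of a product depends on the first component of its leftmost factor. Making
    it nonzero for the variable c alone thus selects the monomials with center c. *)
Definition tdi_var (c i : nat) : tdi_algebra :=
  let e : tfun := [ffun u => (val u == TVar i)%:R] in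
  ((if i == c then e else 0), e).

Lemma tdi_eval c t u :
  (forall x y z, TProd x y z \in s -> [/\ x \in s, y \in s & z \in s]) ->
  u \in s ->
  tval (tmon_eval (tdi_var c) t).2 u = acoef t u /\
  tval (tmon_eval (tdi_var c) t).1 u = (center t == c)%:R * acoef t u.
Proof.
move=> s_closed; elim: t u => [i|t1 IH1 t2 IH2 t3 IH3] u us /=.
  have e : tval [ffun u => (val u == TVar i)%:R] u = acoef (TVar i) u.
    rewrite /tval insubT ffunE /=.
    case: (u) => [j|x y z] //=; case: (i =P j) => [->|ne]; first by rewrite eqxx.
    by case: eqP => // -[e]; case: ne.
  rewrite e; split=> //; case: eqP => _; first by rewrite e mul1r.
  by rewrite /tval insubT ffunE mul0r.
case: u us => [j|x y z] us.
  by rewrite /tval insubT !ffunE /= mulr0.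
have [xs ys zs] := s_closed _ _ _ us; rewrite !tval_talt //=.
have [ax1 ax2] := IH1 _ xs; have [ay1 ay2] := IH1 _ ys.
have [az1 az2] := IH1 _ zs.
have [bx _] := IH2 _ xs; have [bY _] := IH2 _ ys; have [bz _] := IH2 _ zs.
have [cx _] := IH3 _ xs; have [cy _] := IH3 _ ys; have [cz _] := IH3 _ zs.
by rewrite /alt3 !(ax1, ax2, ay1, ay2, az1, az2, bx, bY, bz, cx, cy, cz);
   split=> //; ring.
Qed.

End TestAlgebra.

Fixpoint subterms (t : tmon) : seq tmon :=
  t :: if t is TProd x y z then subterms x ++ subterms y ++ subterms z else [::].

Lemma subterms_refl t : t \in subterms t.
Proof. by case: t => *; rewrite mem_head. Qed.

Lemma subterms_closed t x y z : TProd x y z \in subterms t ->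
  [/\ x \in subterms t, y \in subterms t & z \in subterms t].
Proof.
elim: t => [i|t1 IH1 t2 IH2 t3 IH3]; first by rewrite inE.
rewrite [subterms _]/= inE => /orP[/eqP[-> -> ->]|].
  by rewrite !inE !mem_cat !subterms_refl !orbT.
rewrite !inE !mem_cat => /or3P[/IH1|/IH2|/IH3] [-> -> ->]; by rewrite !orbT.
Qed.

(** The polynomial is evaluated in the test algebra on the subterms of u; the first component of its
    value at u is the coordinate. *)
Lemma consequence_phi n (f : mlpoly n) : consequence_of_PQ f ->
  forall c u, phi f c u = 0.
Proof.
move=> Hf c u.
have /(congr1 (fun x => tval x.1 u)) := Hf _ (@tdi_P (subterms u))
  (@tdi_Q (subterms u)) (tdi_var (subterms u) c).
have tv0 : tval (0 : tfun (subterms u)) u = 0.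
  by rewrite /tval; case: insub => // v; rewrite ffunE.
rewrite /= tv0 => <-; rewrite /mlpoly_eval.
rewrite (big_morph (fun x : tdi_algebra (subterms u) => tval x.1 u)
  (id1 := 0) (op1 := +%R)); last first.
- exact: tv0.
- by move=> x y; have := tvalP 1 x.1 y.1 u; rewrite scale1r mul1r.
rewrite /phi big_mkcond; apply: eq_bigr => m _ /=.
have := tvalP (f m) (tmon_eval (tdi_var (subterms u) c) m).1 0 u.
rewrite addr0 tv0 addr0 => ->.
have [_ ->] := tdi_eval c m (@subterms_closed u) (subterms_refl u).
by case: eqP; rewrite ?mul0r ?mulr0 ?mul1r.
Qed.

Section Evaluation.
Variables (A : ternaryAlgebra) (v : nat -> A).
Hypotheses (AP : satisfies A P_ident) (AQ : satisfies A Q_ident).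

Local Notation op := (@ta_op A).
Local Notation ev := (tmon_eval v).

Lemma op_scale1 k (x y z : A) : op (k *: x) y z = k *: op x y z.
Proof.
have [l1 _ _] := @ta_opP A.
exact: linZ (l1 _ _) k _.
Qed.

Lemma op_scale2 k (x y z : A) : op x (k *: y) z = k *: op x y z.
Proof.
have [_ l2 _] := @ta_opP A.
exact: linZ (l2 _ _) k _.
Qed.

Lemma op_swap23 (a b c : A) : op a c b = -1 *: op a b c.
Proof. by apply/eqP; rewrite scaleN1r -addr_eq0 addrC (satisfies_P A).1. Qed.

Lemma op_swap12 (a b c d e : A) :
  op a (op c b d) e = -1 *: op a (op b c d) e.
Proof. by apply/eqP; rewrite scaleN1r -addr_eq0 addrC (satisfies_Q A).1. Qed.

(** Off the path to the center, P exchanges the last two factors of a product and Q the first two,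
    so all permutations of the factors are available. *)
Lemma tequiv_op k t u a b : tequiv k t u -> op a (ev t) b = k *: op a (ev u) b.
Proof.
move=> h; elim: h a b => {k t u} [i|k1 k2 k3 t1 t2 t3 u1 u2 u3 _ h1 _ h2 _ h3
  |k t u1 u2 u3 _ h|k t u1 u2 u3 _ h] a b /=.
- by rewrite scale1r.
(* Each child in turn is brought to the middle position, where its induction hypothesis applies, and
   then moved back. *)
- rewrite h2 (op_swap23 _ (ev t3)) h3 (op_swap23 _ (ev u2)) !op_scale2.
  rewrite (op_swap12 _ (ev u2)) h1 op_scale2 (op_swap12 _ (ev u1)) !scalerA.
  congr (_ *: _); ring.
- by rewrite h /= (op_swap12 _ (ev u2)) scalerA mulrN1.
- by rewrite h /= (op_swap23 _ (ev u3)) op_scale2 scalerA mulrN1.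
Qed.

(* Only for equal centers do equivalent monomials have proportional values:
   products in the central position are not alternating. *)
Lemma acoef_eval t u : uniq (tleaves t) -> uniq (tleaves u) ->
  center t = center u -> acoef t u != 0 -> ev t = acoef t u *: ev u.
Proof.
elim: t u => [i|t1 IH1 t2 _ t3 _] [j|u1 u2 u3] //=.
  by move=> _ _ ->; rewrite eqxx scale1r.
move=> /uniq_cat3[[U1 U2 U3] [d12 d13 d23]] /uniq_cat3[[V1 V2 V3] [e12 e13 e23]] cc.
have ct := center_leaves t1; have cu := center_leaves u1.
(* The common center lies in both first children, so [t1] must be matched with [u1] and two of the
   six terms remain. *)
have a21 : acoef t2 u1 = 0 by rewrite acoef_sym (acoef_disj cu) // -cc d12.
have a31 : acoef t3 u1 = 0 by rewrite acoef_sym (acoef_disj cu) // -cc d13.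
have -> : alt3 (fun x y z => acoef t1 x * acoef t2 y * acoef t3 z) u1 u2 u3
  = acoef t1 u1 * (acoef t2 u2 * acoef t3 u3 - acoef t2 u3 * acoef t3 u2).
  by rewrite /alt3 a21 a31; ring.
rewrite mulf_eq0 negb_or => /andP[a11 det].
rewrite (IH1 u1) // op_scale1 -scalerA; congr (_ *: _).
have key x y : uniq (tleaves x) -> uniq (tleaves y) ->
    acoef t2 x * acoef t3 y != 0 ->
    op (ev u1) (ev t2) (ev t3) = (acoef t2 x * acoef t3 y) *: op (ev u1) (ev x) (ev y).
  move=> ux uy; rewrite mulf_eq0 negb_or => /andP[h2 h3].
  rewrite (tequiv_op _ _ (acoef_tequiv ux h2)) (op_swap23 _ (ev t3)).
  rewrite (tequiv_op _ _ (acoef_tequiv uy h3)) (op_swap23 _ (ev x)) !scalerA.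
  congr (_ *: _); ring.
have c2 := center_leaves t2.
(* At most one of the two products is nonzero: the center of [t2] is a leaf of at most one of [u2]
   and [u3]. In the second case the sign is that of the exchange given by P. *)
have [c2u|c2u] := boolP (center t2 \in tleaves u2).
  have -> : acoef t2 u3 = 0 by apply: (acoef_disj c2); apply: e23.
  move: det; rewrite (acoef_disj c2 (e23 _ c2u)) mul0r subr0 => det.
  by rewrite (key u2 u3).
move: det; rewrite (acoef_disj c2 c2u) mul0r sub0r oppr_eq0 => det.
by rewrite (key u3 u2) // (op_swap23 _ (ev u2)) scalerA mulrN1.
Qed.

End Evaluation.

Section Representatives.
Variable n : nat.
Implicit Types m u : mlmon n.

Definition same_class m u : bool :=
  (center u == center m) && (acoef m u != 0).

(** The choice is made from the predicate [same_class m], which is the same for all members of a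
    class, so they share one representative. By reflexivity the default is never reached. *)
Definition rep m : mlmon n := odflt m [pick u | same_class m u].

Lemma same_class_refl m : same_class m m.
Proof. by rewrite /same_class eqxx acoef_refl ?oner_eq0 // mlmon_uniq. Qed.

Lemma same_class_rep m : same_class m (rep m).
Proof.
by rewrite /rep; case: pickP => [u|/(_ m)]; rewrite ?same_class_refl.
Qed.

Lemma same_class_trans m m' : same_class m m' -> same_class m =1 same_class m'.
Proof.
move=> /andP[/eqP cc h] u; rewrite /same_class cc.
have e := acoef_tequiv (mlmon_uniq m') h.
by rewrite (tequiv_acoefl u e) mulf_eq0 negb_or h.
Qed.

Lemma rep_eq m m' : same_class m m' -> rep m = rep m'.
Proof.
move=> h; rewrite /rep (eq_pick (same_class_trans h)).
by case: pickP => [//|/(_ m')]; rewrite same_class_refl.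
Qed.

Lemma rep_id m : rep (rep m) = rep m.
Proof. by apply/esym/rep_eq/same_class_rep. Qed.

Lemma rep_class m u : rep u = u -> (rep m == u) = same_class m u.
Proof.
move=> ru; apply/eqP/idP => [<-|h]; first exact: same_class_rep.
by rewrite -ru; apply: rep_eq.
Qed.

End Representatives.

(** Replacing each monomial by a multiple of the representative of its class leaves, at a
    representative u, exactly the coordinate of f at u for the center of u. *)
Lemma phi_consequence n (f : mlpoly n) :
  (forall u : mlmon n, phi f (center u) u = 0) -> consequence_of_PQ f.
Proof.
move=> f0 A AP AQ v; rewrite /mlpoly_eval.
rewrite (eq_bigr (fun m => ((f m : rat) * acoef m (rep m)) *: tmon_eval v (rep m))).
  rewrite (partition_big (@rep n) predT) //= big1 // => u _.
  have [ru|ru] := eqVneq (rep u) u; last first.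
    by rewrite big1 // => m /eqP mu; rewrite -mu rep_id eqxx in ru.
  rewrite (eq_bigr (fun m => ((f m : rat) * acoef m u) *: tmon_eval v u)); last first.
    by move=> m /eqP ->.
  rewrite -scaler_suml; suff -> : \sum_(m | rep m == u) (f m : rat) * acoef m u = 0.
    by rewrite scale0r.
  rewrite -[RHS](f0 u) /phi big_mkcond [RHS]big_mkcond; apply: eq_bigr => m _.
  rewrite rep_class // /same_class eq_sym; case: eqP => //= _.
  by case: eqP => //= ->; rewrite mulr0.
move=> m _; have /andP[/eqP cc h] := same_class_rep m.
by rewrite -scalerA -acoef_eval ?mlmon_uniq.
Qed.

(** * Partially alternating ternary sums as dialgebra words *)

Definition triples (T : Type) (a b c : seq T) : seq (T * T * T) :=
  [seq (p.1, p.2, z) | p <- [seq (x, y) | x <- a, y <- b], z <- c].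

Lemma sum_triples (T : Type) (V : zmodType) (a b c : seq T) (F : T -> T -> T -> V) :
  \sum_(q <- triples a b c) F q.1.1 q.1.2 q.2 =
  \sum_(x <- a) \sum_(y <- b) \sum_(z <- c) F x y z.
Proof. by rewrite /triples !big_allpairs_dep. Qed.

Definition signed_perms (q : (rat * tmon) * (rat * tmon) * (rat * tmon)) :
    seq (rat * tmon) :=
  let: (x, y, z) := q in let k := x.1 * y.1 * z.1 in
  [:: (k, TProd x.2 y.2 z.2); (- k, TProd x.2 z.2 y.2); (- k, TProd y.2 x.2 z.2);
      (k, TProd z.2 x.2 y.2); (k, TProd y.2 z.2 x.2); (- k, TProd z.2 y.2 x.2)].

(** Whole trees are kept, although a dialgebra only sees their leaf words, so that the coefficients
    are those of [acoef]. *)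
Fixpoint expand (t : tmon) : seq (rat * tmon) :=
  match t with
  | TVar i => [:: (1, TVar i)]
  | TProd t1 t2 t3 =>
      flatten (map signed_perms (triples (expand t1) (expand t2) (expand t3)))
  end.

Lemma big_expand (V : lmodType rat) (F : tmon -> V) t1 t2 t3 :
  \sum_(q <- expand (TProd t1 t2 t3)) q.1 *: F q.2 =
  \sum_(q <- triples (expand t1) (expand t2) (expand t3))
     (q.1.1.1 * q.1.2.1 * q.2.1) *:
       alt3 (fun x y z => F (TProd x y z)) q.1.1.2 q.1.2.2 q.2.2.
Proof.
rewrite big_flatten big_map; apply: eq_bigr => -[[x y] z] _.
rewrite /signed_perms !big_cons big_nil /= addr0 !scaleNr /alt3.
by rewrite !(scalerDr, scalerN) !addrA.
Qed.

Lemma acoef_expand t u :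
  acoef t u = \sum_(q <- expand t) q.1 * (q.2 == u)%:R.
Proof.
elim: t u => [i|t1 IH1 t2 IH2 t3 IH3] u.
  rewrite big_seq1 mul1r /=; case: u => [j|x y z] //=.
  case: (i =P j) => [->|ne]; first by rewrite eqxx.
  by case: eqP => // -[e]; case: ne.
transitivity (\sum_(q <- triples (expand t1) (expand t2) (expand t3))
   (q.1.1.1 * q.1.2.1 * q.2.1) *
     alt3 (fun x y z => (TProd x y z == u)%:R : rat) q.1.1.2 q.1.2.2 q.2.2);
  last exact/esym/(big_expand (fun t => (t == u)%:R : rat^o)).
case: u => [j|x y z] /=.
  rewrite big1 // => q _; rewrite /alt3.
  by rewrite /= !(subr0, addr0) mulr0.
have eqE a b c x' y' z' : ((TProd a b c == TProd x' y' z')%:R : rat)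
    = (a == x')%:R * (b == y')%:R * (c == z')%:R.
  rewrite -!natrM !mulnb; congr (_%:R); congr nat_of_bool.
  by apply/eqP/andP => [[-> -> ->]|[/andP[/eqP-> /eqP->] /eqP->]]; rewrite ?eqxx.
have prodE x' y' z' : acoef t1 x' * acoef t2 y' * acoef t3 z' =
    \sum_(q <- triples (expand t1) (expand t2) (expand t3))
       (q.1.1.1 * q.1.2.1 * q.2.1) *
         ((q.1.1.2 == x')%:R * (q.1.2.2 == y')%:R * (q.2.2 == z')%:R).
  rewrite (sum_triples _ _ _ (fun a b c => (a.1 * b.1 * c.1) *
    ((a.2 == x')%:R * (b.2 == y')%:R * (c.2 == z')%:R))).
  rewrite IH1 IH2 IH3 -mulrA mulr_suml; apply: eq_bigr => a _.
  rewrite mulr_suml mulr_sumr; apply: eq_bigr => b _.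
  rewrite !mulr_sumr; apply: eq_bigr => c _.
  ring.
rewrite /alt3 !prodE.
under [RHS]eq_bigr do rewrite !eqE !(mulrDr, mulrN).
rewrite !(big_split, sumrN) /= [X in X - _ = _]addrAC; congr (_ - _ - _ + _ + _ - _);
  apply: eq_bigr => q _; ring.
Qed.

Lemma expand_perm t q : q \in expand t -> perm_eq (tleaves t) (tleaves q.2).
Proof.
elim: t q => [i|t1 IH1 t2 IH2 t3 IH3] q; first by rewrite inE => /eqP ->.
case/flatten_mapP => -[[x y] z] /allpairsP[[p z'] [/= /allpairsP[[x' y']]]].
move=> [/= /IH1 h1 /IH2 h2 -> /IH3 h3 [-> -> ->]] {p x y z} hq.
have h : perm_eq (tleaves t1 ++ tleaves t2 ++ tleaves t3)
    (tleaves x'.2 ++ tleaves y'.2 ++ tleaves z'.2) by rewrite !perm_cat.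
apply: (perm_trans h); move: hq.
by rewrite !inE => /orP[/eqP ->|/orP[/eqP ->|/orP[/eqP ->|/orP[/eqP ->|
  /orP[/eqP ->|/eqP ->]]]]] /=; apply/permP => a; rewrite !count_cat; lia.
Qed.

Section Words.
Variables (D : dialgebra) (v : nat -> D).
Local Notation "a -| b" := (@da_l D a b) (at level 40, left associativity).
Local Notation "a |- b" := (@da_r D a b) (at level 40, left associativity).

Definition ladd (x : D) (w : seq nat) : D := foldl (fun y i => y -| v i) x w.
Definition radd (w : seq nat) (x : D) : D := foldr (fun i y => v i |- y) x w.

(* The dialgebra monomial of the word w with center at the letter c. *)
Fixpoint dword (w : seq nat) (c : nat) : D :=
  if w is i :: w' then if i == c then ladd (v i) w' else v i |- dword w' c
  else 0.

Lemma l_ladd x y w : x -| ladd y w = ladd (x -| y) w.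
Proof. by elim: w y => //= i w IH y; rewrite IH da_llA. Qed.

Lemma ladd_r x y w : ladd y w |- x = y |- radd w x.
Proof. by elim: w y => //= i w IH y; rewrite IH da_barl da_rrA. Qed.

Lemma r_ladd x y w : x |- ladd y w = ladd (x |- y) w.
Proof. by elim: w y => //= i w IH y; rewrite IH da_rlA. Qed.

(** The bar identity [da_barr] makes the right factor forget its center. *)
Lemma l_dword x w c : c \in w -> x -| dword w c = ladd x w.
Proof.
elim: w x => //= i w IH x; rewrite inE eq_sym.
case: (i =P c) => [_ _|_ /= cw]; first by rewrite l_ladd.
by rewrite -da_barr -da_llA IH.
Qed.

Lemma dword_r x w c : c \in w -> dword w c |- x = radd w x.
Proof.
elim: w => //= i w IH; rewrite inE eq_sym.
case: (i =P c) => [_ _|_ /= cw]; first by rewrite ladd_r.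
by rewrite da_rrA IH.
Qed.

Lemma dword_catl w1 w2 c : c \in w1 -> dword (w1 ++ w2) c = ladd (dword w1 c) w2.
Proof.
elim: w1 => //= i w IH; rewrite inE eq_sym.
case: (i =P c) => [_ _|_ /= cw]; first by rewrite /ladd foldl_cat.
by rewrite IH // r_ladd.
Qed.

Lemma dword_catr w1 w2 c : c \notin w1 ->
  dword (w1 ++ w2) c = radd w1 (dword w2 c).
Proof.
elim: w1 => //= i w IH; rewrite inE eq_sym.
by case: (i =P c) => //= _ /IH ->.
Qed.

(** In each of the six terms the products point to the first argument. The other two arguments lose
    their centers by the bar identities, and the words are concatenated around [c1]. *)
Lemma pats_dword w1 w2 w3 c1 c2 c3 :
  c1 \in w1 -> c1 \notin w2 -> c1 \notin w3 -> c2 \in w2 -> c3 \in w3 ->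
  pats (dword w1 c1) (dword w2 c2) (dword w3 c3) =
  alt3 (fun x y z => dword (x ++ y ++ z) c1) w1 w2 w3.
Proof.
move=> h1 n2 n3 h2 h3; rewrite /pats /alt3.
rewrite !(l_dword _ h2) !(l_dword _ h3).
rewrite da_rrA (da_rrA (dword w3 c3)) !(dword_r _ h2) !(dword_r _ h3).
have lc x a b : ladd (ladd x a) b = ladd x (a ++ b) by rewrite /ladd foldl_cat.
rewrite !lc !(dword_catr _ n2, dword_catr _ n3, dword_catl _ h1).
have rl a x b : radd a (ladd x b) = ladd (radd a x) b.
  by rewrite /radd; elim: a => //= i a ->; rewrite r_ladd.
by rewrite !rl.
Qed.

Section Trilinear.
Variables (A : ternaryAlgebra) (I : Type).
Implicit Types (r : seq I) (F : I -> A).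

Lemma op_sum1 r F (y z : A) :
  ta_op (\sum_(i <- r) F i) y z = \sum_(i <- r) ta_op (F i) y z.
Proof.
have [l1 _ _] := @ta_opP A.
apply: (big_morph (fun x => ta_op x y z)); first exact: (linD (l1 y z)).
exact: (lin0 (l1 y z)).
Qed.

Lemma op_sum2 r F (x z : A) :
  ta_op x (\sum_(i <- r) F i) z = \sum_(i <- r) ta_op x (F i) z.
Proof.
have [_ l2 _] := @ta_opP A.
apply: (big_morph (fun y => ta_op x y z)); first exact: (linD (l2 x z)).
exact: (lin0 (l2 x z)).
Qed.

Lemma op_sum3 r F (x y : A) :
  ta_op x y (\sum_(i <- r) F i) = \sum_(i <- r) ta_op x y (F i).
Proof.
have [_ _ l3] := @ta_opP A.
apply: (big_morph (fun z => ta_op x y z)); first exact: (linD (l3 x y)).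
exact: (lin0 (l3 x y)).
Qed.

End Trilinear.

Lemma op_triples (A : ternaryAlgebra) (F1 F2 F3 : tmon -> A) r1 r2 r3 :
  ta_op (\sum_(q <- r1) q.1 *: F1 q.2) (\sum_(q <- r2) q.1 *: F2 q.2)
        (\sum_(q <- r3) q.1 *: F3 q.2) =
  \sum_(q <- triples r1 r2 r3) (q.1.1.1 * q.1.2.1 * q.2.1) *:
     ta_op (F1 q.1.1.2) (F2 q.1.2.2) (F3 q.2.2).
Proof.
rewrite (sum_triples _ _ _ (fun a b c => (a.1 * b.1 * c.1) *:
    ta_op (F1 a.2) (F2 b.2) (F3 c.2))).
have [l1 l2 l3] := @ta_opP A.
rewrite op_sum1; apply: eq_bigr => a _; rewrite op_sum2; apply: eq_bigr => b _.
rewrite op_sum3; apply: eq_bigr => c _.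
by rewrite (linZ (l1 _ _)) (linZ (l2 _ _)) (linZ (l3 _ _)) !scalerA.
Qed.

Lemma pats_eval_expand t : uniq (tleaves t) ->
  tmon_eval (A := pats_algebra D) v t =
  \sum_(q <- expand t) q.1 *: (dword (tleaves q.2) (center t) : pats_algebra D).
Proof.
elim: t => [i|t1 IH1 t2 IH2 t3 IH3].
  by rewrite /= big_seq1 scale1r /= eqxx.
move=> /uniq_cat3[[U1 U2 U3] [d12 d13 d23]].
rewrite (big_expand (fun q => dword (tleaves q) (center (TProd t1 t2 t3)) : pats_algebra D)).
rewrite [LHS]/= IH1 // IH2 // IH3 //.
apply: etrans (op_triples (A := pats_algebra D)
  (fun q => dword (tleaves q) (center t1)) (fun q => dword (tleaves q) (center t2))
  (fun q => dword (tleaves q) (center t3)) _ _ _) _.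
apply: eq_big_seq => -[[x y] z] /allpairsP[[p z'] [/= /allpairsP[[x' y']]]].
move=> [/= /expand_perm h1 /expand_perm h2 -> /expand_perm h3 [-> -> ->]].
congr (_ *: _); rewrite /= pats_dword //.
- by rewrite -(perm_mem h1) center_leaves.
- by rewrite -(perm_mem h2) d12 // center_leaves.
- by rewrite -(perm_mem h3) d13 // center_leaves.
- by rewrite -(perm_mem h2) center_leaves.
- by rewrite -(perm_mem h3) center_leaves.
Qed.

Lemma pats_mlmon_eval n (m : mlmon n) :
  tmon_eval (A := pats_algebra D) v m =
  \sum_(p : mlmon n) acoef m p *: (dword (tleaves p) (center m) : pats_algebra D).
Proof.
rewrite pats_eval_expand ?mlmon_uniq //.
under [RHS]eq_bigr do rewrite acoef_expand scaler_suml.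
rewrite exchange_big /=; apply: eq_big_seq => q /expand_perm hq.
have qP : multilinear n q.2.
  by rewrite /multilinear -(permPl hq); apply: (valP m).
rewrite (bigD1 (MlMon qP)) //= eqxx big1 => [|p pq].
  by rewrite addr0 mulr1.
have /negPf -> : q.2 != p by apply: contraNneq pq => e; apply/eqP/val_inj.
by rewrite mulr0 scale0r.
Qed.

(** Trees with the same leaf word and the same center have the same value, so their coordinates add
    up. *)
Lemma pats_poly_eval n (f : mlpoly n) :
  mlpoly_eval (A := pats_algebra D) v f =
  \sum_(c < n) \sum_(w <- permutations (iota 0 n))
    (\sum_(p : mlmon n | tleaves p == w) phi f c p) *:
      (dword w c : pats_algebra D).
Proof.
transitivity (\sum_(c < n) \sum_(p : mlmon n)
  phi f c p *: (dword (tleaves p) c : pats_algebra D)); last first.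
  apply: eq_bigr => c _.
  under [RHS]eq_bigr do rewrite scaler_suml big_mkcond.
  rewrite exchange_big /=; apply: eq_bigr => p _.
  rewrite (bigD1_seq (tleaves p)) ?permutations_uniq //=; last first.
    by rewrite mem_permutations; apply: (valP p).
  by rewrite eqxx big1 ?addr0 // => w; rewrite eq_sym => /negPf ->.
rewrite /mlpoly_eval.
under eq_bigr do rewrite pats_mlmon_eval scaler_sumr.
rewrite exchange_big [RHS]exchange_big /=; apply: eq_bigr => p _.
have cP (m : mlmon n) : (center m < n)%N.
  by have := center_leaves m; rewrite (perm_mem (valP m)) mem_iota.
rewrite (partition_big (fun m => Ordinal (cP m)) predT) //=.
apply: eq_bigr => c _; rewrite /phi scaler_suml.
apply: eq_big => [m|m /eqP <-]; first by rewrite -val_eqE.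
by rewrite scalerA.
Qed.

End Words.

(** * Separating words by matrix units *)

Section TestDialgebra.
Variable n : nat.
Notation M := 'M[rat]_n.+1.
Implicit Types x y z : (M * M)%type.

(* As in [tdi_op], the first component is the part with a given center. *)
Definition mx_l x y : (M * M)%type := (x.1 *m y.2, x.2 *m y.2).
Definition mx_r x y : (M * M)%type := (x.2 *m y.1, x.2 *m y.2).

Lemma mx_l_linearl y : linear (fun x => mx_l x y).
Proof. by move=> k x z; rewrite /mx_l /= !mulmxDl -!scalemxAl. Qed.

Lemma mx_l_linearr x : linear (fun y => mx_l x y).
Proof. by move=> k y z; rewrite /mx_l /= !mulmxDr -!scalemxAr. Qed.

Lemma mx_r_linearl y : linear (fun x => mx_r x y).
Proof. by move=> k x z; rewrite /mx_r /= !mulmxDl -!scalemxAl. Qed.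

Lemma mx_r_linearr x : linear (fun y => mx_r x y).
Proof. by move=> k y z; rewrite /mx_r /= !mulmxDr -!scalemxAr. Qed.

Definition mx_dialgebra : dialgebra.
Proof.
apply: (@Dialgebra (M * M)%type mx_l mx_r mx_l_linearl mx_l_linearr
  mx_r_linearl mx_r_linearr); by move=> a b c; rewrite /mx_l /mx_r /= ?mulmxA.
Defined.

Variables (w0 : seq nat) (c0 : nat).
Hypothesis w0n : size w0 = n.

(** The matrix unit of the step from the position of i in [w0] to the next one. A word of [n]
    letters leads from 0 to [n] only if it takes these steps in order, that is, if it equals
    [w0]. *)
Definition edge (i : nat) : M :=
  delta_mx (inord (index i w0)) (inord (index i w0).+1).

Definition mx_var (i : nat) : mx_dialgebra :=
  (if i == c0 then edge i else 0, edge i).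

Definition walk (w : seq nat) : M := foldr (fun i X => edge i *m X) 1%:M w.

Lemma walkE w a : {subset w <= w0} -> (a <= n)%N ->
  walk w (inord a) (inord n) =
  (([seq index i w0 | i <- w] == iota a (size w)) && (a + size w == n)%N)%:R.
Proof.
elim: w a => [|i w IH] a sw an.
  by rewrite mxE addn0 -val_eqE /= !inordK.
rewrite [walk _]/= [size _]/= [map _ _]/= [iota _ _]/= eqseq_cons addnS -addSn.
have iw : (index i w0 < n)%N by rewrite -w0n index_mem sw ?mem_head.
rewrite mxE (bigD1 (inord (index i w0).+1)) //= big1 ?addr0 => [|k /negPf kn].
  rewrite mxE eqxx andbT IH //; last by move=> j jw; rewrite sw // inE jw orbT.
  rewrite -val_eqE [_ == _]/= !inordK ?ltnS ?(ltnW iw) //.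
  by case: (eqVneq a (index i w0)) => [->|_]; rewrite ?mul0r ?mul1r.
by rewrite mxE kn andbF mul0r.
Qed.

Lemma walk_perm w : perm_eq w w0 -> uniq w0 ->
  walk w (inord 0) (inord n) = (w == w0)%:R.
Proof.
move=> ww uw; have sw := perm_size ww.
rewrite walkE => [|i|] //; last by rewrite (perm_mem ww).
rewrite add0n sw w0n eqxx andbT; congr (_%:R); congr nat_of_bool.
have e0 : [seq index i w0 | i <- w0] = iota 0 n.
  apply: (@eq_from_nth _ 0%N) => [|i]; rewrite size_map ?size_iota // => iw.
  by rewrite (nth_map 0%N) // index_uniq // nth_iota -?w0n.
apply/eqP/eqP => [|->] //; rewrite -e0 => e.
apply: (inj_in_map (A := mem w0) (f := index^~ w0)) e.
- by move=> i j iw jw /(congr1 (nth 0%N w0)); rewrite !nth_index.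
- by apply/allP => i; rewrite (perm_mem ww).
- by apply/allP => i.
Qed.

Lemma mx_ladd (x : mx_dialgebra) w :
  ladd mx_var x w = (x.1 *m walk w, x.2 *m walk w).
Proof.
elim: w x => [|i w IH] x /=; first by rewrite !mulmx1; case: x.
by rewrite IH /= /mx_l /= !mulmxA.
Qed.

Lemma mx_dword w c : c \in w ->
  dword mx_var w c = ((if c == c0 then walk w else 0), walk w).
Proof.
elim: w => //= i w IH; rewrite inE eq_sym; case: (i =P c) => [-> _|_ /= cw].
  by rewrite mx_ladd /=; case: ifP; rewrite ?mul0mx.
by rewrite IH //= /mx_r /=; case: ifP; rewrite ?mulmx0.
Qed.

Definition entry (x : mx_dialgebra) : rat^o := (x : (M * M)%type).1 (inord 0) (inord n).

Lemma entry_linear : linear entry.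
Proof. by move=> a x y; rewrite /entry /= !mxE. Qed.

Lemma entry_sum (I : Type) (r : seq I) (P : pred I) (F : I -> mx_dialgebra) :
  entry (\sum_(i <- r | P i) F i) = \sum_(i <- r | P i) entry (F i).
Proof. exact: (big_morph entry (linD entry_linear) (lin0 entry_linear)). Qed.

End TestDialgebra.

Lemma satisfied_by_PATS_phi n (f : mlpoly n) : satisfied_by_PATS f <->
  forall (c : 'I_n) w, perm_eq w (iota 0 n) ->
    \sum_(p : mlmon n | tleaves p == w) phi f c p = 0.
Proof.
split=> [Hf c w pw|Hf D v]; last first.
  rewrite pats_poly_eval big1 // => c _; apply: big1_seq => w /andP[_].
  by rewrite mem_permutations => pw; rewrite Hf // scale0r.
have wn : size w = n by rewrite (perm_size pw) size_iota.
have wu : uniq w by rewrite (perm_uniq pw) iota_uniq.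
have : \sum_(c' < n) \sum_(w' <- permutations (iota 0 n))
    (\sum_(p : mlmon n | tleaves p == w') phi f c' p) *: dword (mx_var n w c) w' c' = 0.
  exact: etrans (esym (pats_poly_eval (mx_var n w c) f)) (Hf (mx_dialgebra n) (mx_var n w c)).
(* The corner entry of the first component isolates one summand: other centers have zero first
   component, other words have zero corner entry. *)
move=> /(congr1 (@entry n)).
rewrite [RHS](lin0 (@entry_linear n)) entry_sum (bigD1 c) //= [X in _ + X]big1.
  rewrite addr0 entry_sum (bigD1_seq w) ?permutations_uniq ?mem_permutations //=.
  rewrite [X in _ + X]big1_seq ?addr0 => [|w' /andP[w'w]]; rewrite (linZ (@entry_linear n)).
    rewrite mx_dword ?(perm_mem pw) ?mem_iota //= eqxx /entry /=.
    by rewrite walk_perm // eqxx /GRing.scale /= mulr1.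
  rewrite mem_permutations => pw'.
  rewrite mx_dword ?(perm_mem pw') ?mem_iota //= eqxx /entry /=.
  rewrite walk_perm ?(negPf w'w) ?scaler0 //.
  by rewrite (perm_trans pw') // perm_sym.
move=> c' c'c; rewrite entry_sum big1_seq // => w' /andP[_].
rewrite mem_permutations => pw'.
rewrite (linZ (@entry_linear n)) mx_dword ?(perm_mem pw') ?mem_iota //=.
rewrite -val_eqE /= in c'c.
by rewrite (negPf c'c) /entry /= mxE scaler0.
Qed.

(** * The linear equations on trees with seven leaves *)

Lemma tleaves_tmap r t : tleaves (tmap r t) = map r (tleaves t).
Proof. by elim: t => //= t1 -> t2 -> t3 ->; rewrite !map_cat. Qed.

Lemma tmap_comp r s t : tmap r (tmap s t) = tmap (r \o s) t.
Proof. by elim: t => //= t1 -> t2 -> t3 ->. Qed.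

Lemma eq_in_tmap r s t : {in tleaves t, r =1 s} -> tmap r t = tmap s t.
Proof.
elim: t => [i|t1 IH1 t2 IH2 t3 IH3] /= h; first by rewrite h ?mem_head.
by rewrite IH1 ?IH2 ?IH3 // => i it; apply: h; rewrite !mem_cat it ?orbT.
Qed.

Lemma tmap_id_in r t : {in tleaves t, r =1 id} -> tmap r t = t.
Proof. by move=> /eq_in_tmap ->; elim: t => //= t1 -> t2 -> t3 ->. Qed.

(* The trees of height at most h with leaf word w. *)
Fixpoint planar (h : nat) (w : seq nat) : seq tmon :=
  (if w is [:: i] then [:: TVar i] else [::]) ++
  (if h is h'.+1 then
     flatten [seq flatten
       [seq [seq TProd p.1.1 p.1.2 p.2 | p <- triples (planar h' (take i w))
          (planar h' (take j (drop i w))) (planar h' (drop j (drop i w)))]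
       | j <- iota 1 (size w - 2)] | i <- iota 1 (size w - 2)]
   else [::]).

(** A ternary tree with 2h + 1 leaves has h products, hence height at most h. *)
Lemma mem_planar h t : (size (tleaves t) <= h.*2.+1)%N -> t \in planar h (tleaves t).
Proof.
elim: h t => [|h IH] [i|t1 t2 t3] /= szt.
- by rewrite mem_head.
- move: szt (size_tleaves_gt0 t1) (size_tleaves_gt0 t2) (size_tleaves_gt0 t3).
  by rewrite !size_cat; lia.
- by rewrite mem_head.
have g1 := size_tleaves_gt0 t1; have g2 := size_tleaves_gt0 t2.
have g3 := size_tleaves_gt0 t3; rewrite !size_cat in szt.
rewrite mem_cat; apply/orP; right; apply/flatten_mapP.
exists (size (tleaves t1)); first by rewrite mem_iota !size_cat; lia.
apply/flatten_mapP; exists (size (tleaves t2)); first by rewrite mem_iota !size_cat; lia.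
apply/mapP; exists (t1, t2, t3) => //.
rewrite take_size_cat // !drop_size_cat // take_size_cat //.
apply/allpairsP; exists ((t1, t2), t3); split=> //=; last by apply: IH; lia.
by apply/allpairsP; exists (t1, t2); split=> //=; apply: IH; lia.
Qed.

Definition planar7 : seq tmon := planar 3 (iota 0 7).

Lemma planar7_uniq : uniq planar7.
Proof. by vm_compute. Qed.

Lemma planar7_leaves p : p \in planar7 -> tleaves p = iota 0 7.
Proof.
have : all (fun p => tleaves p == iota 0 7) planar7 by vm_compute.
by move=> /allP h /h /eqP.
Qed.

Local Notation "'w[' w ']'" := (nth 0%N w) (at level 0, format "w[ w ]").

Lemma tmap_nth_iota w : size w = 7%N -> map w[w] (iota 0 7) = w.
Proof. by move=> <-; rewrite map_nth_iota0 // take_size. Qed.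

Lemma tmap_index_planar7 t : perm_eq (tleaves t) (iota 0 7) ->
  tmap (index^~ (tleaves t)) t \in planar7 /\
  tmap w[tleaves t] (tmap (index^~ (tleaves t)) t) = t.
Proof.
move=> pt; have sz : size (tleaves t) = 7%N by rewrite (perm_size pt).
have ut : uniq (tleaves t) by rewrite (perm_uniq pt) iota_uniq.
split; last first.
  by rewrite tmap_comp tmap_id_in // => i it; rewrite /= nth_index.
set q := tmap _ _.
have lq : tleaves q = iota 0 7.
  rewrite tleaves_tmap; apply: (@eq_from_nth _ 0%N) => [|i]; rewrite size_map sz //.
  by move=> i7; rewrite (nth_map 0%N) ?sz // nth_iota // index_uniq // sz.
by rewrite /planar7 -lq mem_planar // lq.
Qed.

(** Relabelling along w is a bijection from the planar trees on 0, ..., 6 to those with leaf word w;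
    its inverse replaces each letter by its position in w. *)
Lemma planar7_sum w (G : tmon -> rat) : perm_eq w (iota 0 7) ->
  \sum_(p : mlmon 7 | tleaves p == w) G p =
  \sum_(p <- planar7) G (tmap w[w] p).
Proof.
move=> pw; have sz : size w = 7%N by rewrite (perm_size pw).
have uw : uniq w by rewrite (perm_uniq pw) iota_uniq.
rewrite -big_filter -(big_map val predT G).
rewrite -(big_map (tmap w[w]) predT G); apply: perm_big; apply: uniq_perm.
- by rewrite (map_inj_uniq val_inj) filter_uniq ?index_enum_uniq.
- rewrite map_inj_in_uniq ?planar7_uniq // => p q /planar7_leaves lp /planar7_leaves lq.
  move/(congr1 (tmap (index^~ w))); rewrite !tmap_comp !tmap_id_in // => i;
    rewrite ?lp ?lq mem_iota add0n => i7 /=; by rewrite index_uniq ?sz.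
move=> t; apply/mapP/mapP => [[p]|[q /[dup] qp /planar7_leaves lq ->]].
  rewrite mem_filter => /andP[/eqP lp _] ->.
  have [h1 h2] := tmap_index_planar7 (valP p).
  by exists (tmap (index^~ (tleaves p)) p); rewrite // -lp h2.
have lt : tleaves (tmap w[w] q) = w by rewrite tleaves_tmap lq tmap_nth_iota.
have qP : multilinear 7 (tmap w[w] q) by rewrite /multilinear lt.
by exists (MlMon qP); rewrite // mem_filter mem_index_enum lt eqxx.
Qed.

Fixpoint height (t : tmon) : nat :=
  match t with
  | TVar _ => 0
  | TProd x y z => (maxn (height x) (maxn (height y) (height z))).+1
  end.

Lemma height_tmap r t : height (tmap r t) = height t.
Proof. by elim: t => //= t1 -> t2 -> t3 ->. Qed.

(** Only the shape is normalized, by ordering children by decreasing height; the order of the leaves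
    is left to [sort_word]. *)
Fixpoint nf (t : tmon) : tmon :=
  match t with
  | TVar i => TVar i
  | TProd x y z =>
      let x := nf x in let y := nf y in let z := nf z in
      let a := height x in let b := height y in let c := height z in
      if (b <= a)%N then
        if (c <= b)%N then TProd x y z
        else if (c <= a)%N then TProd x z y else TProd z x y
      else
        if (c <= a)%N then TProd y x z
        else if (c <= b)%N then TProd y z x else TProd z y x
  end.

Lemma nf_tequiv t : exists k, tequiv k t (nf t).
Proof.
elim: t => [i|t1 [k1 h1] t2 [k2 h2] t3 [k3 h3]]; first by exists 1; constructor.
have h := TeqProd h1 h2 h3; have h23 := TeqSwap23 h; have h12 := TeqSwap12 h.
rewrite /=; repeat (case: ifP => _).
- by eexists; exact: h.
- by eexists; exact: h23.
- by eexists; exact: TeqSwap12 h23.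
- by eexists; exact: h12.
- by eexists; exact: TeqSwap23 h12.
- by eexists; exact: TeqSwap12 (TeqSwap23 h12).
Qed.

(* The two classes of ternary trees with seven leaves. *)
Definition class_tree (wide : bool) : tmon :=
  if wide then TProd (TProd (TVar 0) (TVar 1) (TVar 2))
                     (TProd (TVar 3) (TVar 4) (TVar 5)) (TVar 6)
  else TProd (TProd (TProd (TVar 0) (TVar 1) (TVar 2)) (TVar 3) (TVar 4))
             (TVar 5) (TVar 6).

Definition is_wide (t : tmon) : bool := (height t <= 2)%N.

Lemma planar7_class_tree p : p \in planar7 ->
  nf p = tmap w[tleaves (nf p)] (class_tree (is_wide p)).
Proof.
have : all (fun p => nf p == tmap w[tleaves (nf p)] (class_tree (is_wide p))) planar7.
  by vm_compute.
by move=> /allP h /h /eqP.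
Qed.

Lemma tleaves_class_tree b : tleaves (class_tree b) = iota 0 7.
Proof. by case: b. Qed.

Lemma tleaves_nth_class_tree b w : size w = 7%N -> tleaves (tmap w[w] (class_tree b)) = w.
Proof. by move=> sz; rewrite tleaves_tmap tleaves_class_tree tmap_nth_iota. Qed.

Lemma tmap_nth_class_tree v w b : size w = 7%N ->
  tmap w[v] (tmap w[w] (class_tree b)) = tmap w[map w[v] w] (class_tree b).
Proof.
move=> sz; rewrite tmap_comp; apply: eq_in_tmap => i.
by rewrite tleaves_class_tree mem_iota => i7; rewrite (nth_map 0%N) ?sz.
Qed.

Lemma planar7_tequiv p v : p \in planar7 ->
  exists k, tequiv k (tmap w[v] p) (tmap w[map w[v] (tleaves (nf p))] (class_tree (is_wide p))).
Proof.
move=> pp; have [k h] := nf_tequiv p; exists k.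
rewrite -tmap_nth_class_tree -?planar7_class_tree //; first exact: tequiv_tmap.
by rewrite -(perm_size (tequiv_perm h)) planar7_leaves.
Qed.

Lemma planar7_nf_perm p : p \in planar7 -> perm_eq (tleaves (nf p)) (iota 0 7).
Proof.
move=> pp; have [k h] := nf_tequiv p.
by rewrite -(planar7_leaves pp) perm_sym (tequiv_perm h).
Qed.

Lemma perm_relabel v w : perm_eq v (iota 0 7) -> perm_eq w (iota 0 7) ->
  perm_eq (map w[v] w) (iota 0 7).
Proof.
move=> pv pw; rewrite (perm_trans (perm_map _ pw)) // tmap_nth_iota //.
by rewrite (perm_size pv).
Qed.

Lemma exists_class_tree t : multilinear 7 t ->
  exists2 w, perm_eq w (iota 0 7) & exists k, tequiv k t (tmap w[w] (class_tree (is_wide t))).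
Proof.
move=> tP; have [qp qt] := tmap_index_planar7 tP.
have [k h] := planar7_tequiv (tleaves t) qp.
exists (map w[tleaves t] (tleaves (nf (tmap (index^~ (tleaves t)) t)))).
  exact: perm_relabel tP (planar7_nf_perm qp).
by exists k; rewrite qt [is_wide _]/is_wide height_tmap in h.
Qed.

(* Functions constant on the orbits of child permutations whose sums over the
   twelve planar trees of each leaf word vanish. *)
Definition planar_solution (Y : tmon -> rat) : Prop :=
  (forall k t u, tequiv k t u -> multilinear 7 u -> Y t = Y u) /\
  (forall w, perm_eq w (iota 0 7) -> \sum_(p <- planar7) Y (tmap w[w] p) = 0).

Definition on_words (Y : tmon -> rat) (b : bool) (w : seq nat) : rat :=
  Y (tmap w[w] (class_tree b)).

Definition sort2 (a b : nat) : seq nat :=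
  if Nat.leb a b then [:: a; b] else [:: b; a].

Definition sort3 (a b c : nat) : seq nat :=
  if Nat.leb a b then
    if Nat.leb b c then [:: a; b; c]
    else if Nat.leb a c then [:: a; c; b] else [:: c; a; b]
  else
    if Nat.leb a c then [:: b; a; c]
    else if Nat.leb b c then [:: b; c; a] else [:: c; b; a].

(** Normal form of a leaf word under the symmetries of the class tree. Signs are not recorded, since
    the functions considered are invariant after the twist by [wsgn]. *)
Definition sort_word (wide : bool) (w : seq nat) : seq nat :=
  if w is [:: a; b; c; d; e; f; g] then
    if wide then
      let l := sort3 a b c in let r := sort3 d e f in
      (if Nat.leb (head 0 l) (head 0 r) then l ++ r else r ++ l) ++ [:: g]
    else sort3 a b c ++ sort2 d e ++ sort2 f g
  else w.

Lemma sort2P l t u a b : tequiv l t u -> exists x y k, sort2 a b = [:: x; y] /\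
  tequiv k (TProd t (TVar a) (TVar b)) (TProd u (TVar x) (TVar y)).
Proof.
move=> h; have h' := TeqProd h (TeqVar a) (TeqVar b).
rewrite /sort2; case: ifP => _; do 3!eexists; (split; first reflexivity).
  exact: h'.
exact: TeqSwap23 h'.
Qed.

Lemma sort3P a b c : exists x y z k, sort3 a b c = [:: x; y; z] /\
  tequiv k (TProd (TVar a) (TVar b) (TVar c)) (TProd (TVar x) (TVar y) (TVar z)).
Proof.
have h := tequiv_refl (TProd (TVar a) (TVar b) (TVar c)).
rewrite /sort3; repeat (case: ifP => _); do 4!eexists; (split; first reflexivity).
- exact: h.
- exact: TeqSwap23 h.
- exact: TeqSwap12 (TeqSwap23 h).
- exact: TeqSwap12 h.
- exact: TeqSwap23 (TeqSwap12 h).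
- exact: TeqSwap12 (TeqSwap23 (TeqSwap12 h)).
Qed.

Lemma sort_word_tequiv b w : size w = 7%N ->
  exists k, tequiv k (tmap w[w] (class_tree b)) (tmap w[sort_word b w] (class_tree b)).
Proof.
case: w => [|a [|b' [|c [|d [|e [|f [|g [|]]]]]]]] // _.
case: b => /=.
  have [x' [y' [z' [k' [E' h']]]]] := sort3P d e f.
  have [x1 [y1 [z1 [k1 [E1 h1]]]]] := sort3P a b' c.
  have H := TeqProd h1 h' (TeqVar g); rewrite E1 E' /=.
  case: ifP => _; first by eexists; exact: H.
  by eexists; exact: TeqSwap12 H.
have [x1 [y1 [z1 [k1 [E1 h1]]]]] := sort3P a b' c.
have [x' [y' [k' [E' h']]]] := sort2P d e h1.
have [x2 [y2 [k2 [E2 h2]]]] := sort2P f g h'.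
by rewrite E1 E' E2 /=; eexists; exact: h2.
Qed.

Lemma sort_word_perm b w : perm_eq w (iota 0 7) -> perm_eq (sort_word b w) (iota 0 7).
Proof.
move=> pw; have sz : size w = 7%N by rewrite (perm_size pw).
have szs : size (sort_word b w) = 7%N.
  case: (w) sz => [|a [|b' [|c [|d [|e [|f [|g [|]]]]]]]] // _.
  by rewrite /= /sort2 /sort3; case: b; repeat (case: Nat.leb => //=).
have [k /tequiv_perm] := sort_word_tequiv b sz.
by rewrite !tleaves_nth_class_tree // perm_sym => h; apply: perm_trans h pw.
Qed.

Definition patterns (wide : bool) : seq (seq nat) :=
  (if wide then
    [:: [:: 1; 2; 3; 4; 5; 6; 0]; [:: 0; 1; 2; 4; 5; 6; 3]; [:: 0; 1; 2; 3; 4; 5; 6]]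
  else
    [:: [:: 4; 5; 6; 2; 3; 0; 1]; [:: 3; 4; 5; 2; 6; 0; 1]; [:: 2; 3; 4; 5; 6; 0; 1];
        [:: 3; 4; 5; 1; 2; 0; 6]; [:: 2; 3; 4; 1; 5; 0; 6]; [:: 1; 2; 3; 4; 5; 0; 6];
        [:: 2; 3; 4; 0; 1; 5; 6]; [:: 1; 2; 3; 0; 4; 5; 6]; [:: 0; 1; 2; 3; 4; 5; 6]])%N.

Lemma planar7_patterns b :
  [seq tleaves (nf p) | p <- planar7 & is_wide p == b] = patterns b.
Proof. by case: b; vm_compute. Qed.

Lemma patterns_perm b s : s \in patterns b -> perm_eq s (iota 0 7).
Proof.
rewrite -planar7_patterns => /mapP[p]; rewrite mem_filter => /andP[_ pp] ->.
exact: planar7_nf_perm.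
Qed.

(** * Formal sums of words and combinations of the equations *)

Definition sword := (int * seq nat)%type.

(** One level of a trie: splitting by first letters tests cancellation without comparing words with
    each other. *)
Fixpoint bucket (d : nat) (L : seq sword) : seq sword :=
  match L with
  | (c, i :: w) :: L' => if eqn i d then (c, w) :: bucket d L' else bucket d L'
  | _ :: L' => bucket d L'
  | [::] => [::]
  end.

(* L vanishes as a formal sum of words of length n over the alphabet 0, ..., 6. *)
Fixpoint cancels (n : nat) (L : seq sword) : bool :=
  if L is [::] then true
  else if n is n'.+1 then all (fun d => cancels n' (bucket d L)) (iota 0 7)
  else foldr (fun t s => t.1 + s) 0 L == 0.

Definition word_of (n : nat) (w : seq nat) : bool :=
  (size w == n) && all (fun i => (i < 7)%N) w.

Lemma bucket_sum n L (F : seq nat -> rat) : all (word_of n.+1) (map snd L) ->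
  \sum_(t <- L) t.1%:~R * F t.2 =
  \sum_(d <- iota 0 7) \sum_(t <- bucket d L) t.1%:~R * F (d :: t.2).
Proof.
have [us ms] : uniq (iota 0 7) /\ forall i, (i \in iota 0 7) = (i < 7)%N.
  by split=> [|i]; rewrite ?iota_uniq ?mem_iota.
move: (iota 0 7) us ms => s us ms.
elim: L => [|[c [|i w]] L IH] //=.
  by move=> _; rewrite big_nil big1_seq // => d _; rewrite big_nil.
case/andP=> /andP[_ /= /andP[i7 _]] /IH {}IH; rewrite big_cons IH.
rewrite !(bigD1_seq i) ?ms //= ?eqnE eqxx big_cons -addrA; congr (_ + (_ + _)).
by apply: eq_bigr => d /negPf di; rewrite ?eqnE eq_sym di.
Qed.

Lemma bucket_word n d L : all (word_of n.+1) (map snd L) ->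
  all (word_of n) (map snd (bucket d L)).
Proof.
elim: L => [|[c [|i w]] L IH] //= /andP[/andP[sw /andP[_ w7]] /IH {}IH].
by case: eqn => //=; rewrite IH andbT; apply/andP.
Qed.

Lemma cancels_sum n L (F : seq nat -> rat) :
  cancels n L -> all (word_of n) (map snd L) -> \sum_(t <- L) t.1%:~R * F t.2 = 0.
Proof.
elim: n L F => [|n IH] [|t L] F; rewrite ?big_nil // => hL wL.
  transitivity ((foldr (fun t s => t.1 + s) 0 (t :: L))%:~R * F [::]); last first.
    by move/eqP: hL => ->; rewrite mul0r.
  elim: (t :: L) wL {hL} => [|[c w] L' IH]; first by rewrite big_nil mul0r.
  move=> /= /andP[/andP[/nilP -> _] /IH {}IH].
  by rewrite big_cons IH /= intrD mulrDl.
rewrite (bucket_sum F wL) big1_seq // => d /andP[_ d7].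
apply: (IH _ (fun w => F (d :: w))); last exact: bucket_word.
by have /allP := hL; apply.
Qed.

(** The product in the group ring of the symmetric group, a word standing for the permutation that
    sends i to its letter in position i. *)
Definition relabel (gs ws : seq sword) : seq sword :=
  [seq (g.1 * w.1, map w[g.2] w.2) | g <- gs, w <- ws].

(** The part of shape b in the combination [ws] of the twelve-term equations, in normalized
    words. *)
Definition contribution (b : bool) (ws : seq sword) : seq sword :=
  [seq (w.1, sort_word b (map w[w.2] s)) | w <- ws, s <- patterns b].

Definition perm_words (ws : seq sword) : bool :=
  all (fun w => perm_eq w.2 (iota 0 7)) ws.

Section Solutions.
Variable Y : tmon -> rat.
Hypothesis solY : planar_solution Y.

Lemma multilinear_class_tree b w : perm_eq w (iota 0 7) ->
  multilinear 7 (tmap w[w] (class_tree b)).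
Proof. by move=> pw; rewrite /multilinear tleaves_nth_class_tree // (perm_size pw). Qed.

Lemma on_words_sort b w : perm_eq w (iota 0 7) ->
  on_words Y b (sort_word b w) = on_words Y b w.
Proof.
move=> pw; have [k h] := sort_word_tequiv b (etrans (perm_size pw) (size_iota 0 7)).
by apply/esym/(proj1 solY _ _ _ h)/multilinear_class_tree/sort_word_perm.
Qed.

Lemma on_words_equation w : perm_eq w (iota 0 7) ->
  \sum_(s <- patterns true) on_words Y true (map w[w] s) +
  \sum_(s <- patterns false) on_words Y false (map w[w] s) = 0.
Proof.
move=> pw; rewrite -[RHS](proj2 solY _ pw) -!planar7_patterns !big_map !big_filter.
rewrite [RHS](bigID is_wide) /=; congr (_ + _); rewrite big_seq_cond [RHS]big_seq_cond.
  apply: eq_big => [p|p /andP[pp /eqP wp]]; first by rewrite eqb_id.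
  have [k h] := planar7_tequiv w pp; rewrite (proj1 solY _ _ _ h) ?wp //.
  exact/multilinear_class_tree/perm_relabel/planar7_nf_perm.
apply: eq_big => [p|p /andP[pp /eqP wp]]; first by rewrite eqbF_neg.
have [k h] := planar7_tequiv w pp; rewrite (proj1 solY _ _ _ h) ?wp //.
exact/multilinear_class_tree/perm_relabel/planar7_nf_perm.
Qed.

Lemma contribution_sum b ws : perm_words ws ->
  \sum_(t <- contribution b ws) t.1%:~R * on_words Y b t.2 =
  \sum_(w <- ws) w.1%:~R * \sum_(s <- patterns b) on_words Y b (map w[w.2] s).
Proof.
move=> /allP pws; rewrite /contribution big_allpairs_dep /=.
apply: eq_big_seq => w /pws pw; rewrite mulr_sumr; apply: eq_big_seq => s /patterns_perm ps.
by rewrite on_words_sort // perm_relabel.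
Qed.

Lemma perm_word_of w : perm_eq w (iota 0 7) -> word_of 7 w.
Proof.
move=> pw; rewrite /word_of (perm_size pw) eqxx; apply/allP => i.
by rewrite (perm_mem pw) mem_iota.
Qed.

(** A cancellation of formal sums of sorted words passes to the values of a solution, which sorting
    does not change. *)
Lemma contribution_cancels b ws tgt : perm_words ws -> perm_words tgt ->
  cancels 7 (contribution b ws ++ [seq (- t.1, sort_word b t.2) | t <- tgt]) ->
  \sum_(t <- tgt) t.1%:~R * on_words Y b t.2 =
  \sum_(t <- contribution b ws) t.1%:~R * on_words Y b t.2.
Proof.
move=> pws /allP ptgt /(cancels_sum (on_words Y b)) E; apply/esym/eqP.
rewrite -subr_eq0 -[X in _ == X]E.
  rewrite big_cat big_map -sumrN; apply/eqP; congr (_ + _).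
  apply: eq_big_seq => t /ptgt pt /=.
  by rewrite on_words_sort // intrN mulNr.
rewrite map_cat all_cat; apply/andP; split; apply/allP => w.
  case/mapP => t /allpairsP[[w' s] [/= /(allP pws) pw' /patterns_perm ps ->]] -> /=.
  exact/perm_word_of/sort_word_perm/perm_relabel.
by case/mapP => t /mapP[t' /ptgt pt ->] -> /=; apply/perm_word_of/sort_word_perm.
Qed.

End Solutions.

Definition id7 : seq nat := iota 0 7.

(* Linear combinations of equations found by computer, each symmetrized over the
   stabilizer of the relation to be proved, with a sign for the last generator
   in the first case, which exchanges the two sides of the relation. *)
Definition wide_words : seq sword :=
  foldr relabel
    [:: (2%:Z, [:: 0; 2; 1; 6; 4; 3; 5]%N);
        (2%:Z, [:: 0; 4; 2; 3; 1; 5; 6]%N);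
        (- 4%:Z, [:: 0; 1; 2; 4; 6; 3; 5]%N);
        (- 4%:Z, [:: 0; 4; 6; 1; 2; 5; 3]%N);
        (4%:Z, [:: 0; 1; 2; 4; 5; 3; 6]%N)]
    [:: [:: (1%:Z, id7); (1%:Z, [:: 1; 0; 2; 3; 4; 5; 6]%N)];
        [:: (1%:Z, id7); (1%:Z, [:: 0; 1; 2; 3; 5; 4; 6]%N)];
        [:: (1%:Z, id7); (1%:Z, [:: 4; 5; 3; 2; 0; 1; 6]%N)];
        [:: (1%:Z, id7); (- 1%:Z, [:: 0; 1; 3; 2; 4; 5; 6]%N)]].

Definition deep_words : seq sword :=
  foldr relabel
    [:: (- 2%:Z, [:: 3; 5; 0; 1; 2; 4; 6]%N);
        (3%:Z, [:: 5; 3; 0; 1; 2; 4; 6]%N);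
        (- 2%:Z, [:: 0; 5; 6; 1; 3; 2; 4]%N);
        (- 2%:Z, [:: 0; 3; 5; 1; 2; 6; 4]%N);
        (2%:Z, [:: 0; 5; 1; 2; 3; 6; 4]%N);
        (1%:Z, [:: 3; 0; 4; 1; 5; 2; 6]%N);
        (5%:Z, [:: 0; 3; 4; 5; 1; 6; 2]%N);
        (- 5%:Z, [:: 0; 1; 3; 4; 5; 2; 6]%N);
        (1%:Z, [:: 3; 5; 0; 4; 1; 2; 6]%N);
        (6%:Z, [:: 5; 0; 1; 2; 3; 4; 6]%N);
        (3%:Z, [:: 0; 5; 1; 3; 2; 4; 6]%N);
        (- 6%:Z, [:: 5; 0; 1; 3; 2; 4; 6]%N);
        (- 3%:Z, [:: 3; 5; 4; 0; 1; 2; 6]%N)]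
    [:: [:: (1%:Z, id7); (1%:Z, [:: 1; 0; 2; 3; 4; 5; 6]%N)];
        [:: (1%:Z, id7); (1%:Z, [:: 2; 1; 0; 3; 4; 5; 6]%N); (1%:Z, [:: 0; 2; 1; 3; 4; 5; 6]%N)];
        [:: (1%:Z, id7); (1%:Z, [:: 0; 1; 2; 4; 3; 5; 6]%N)];
        [:: (1%:Z, id7); (1%:Z, [:: 0; 1; 2; 3; 4; 6; 5]%N)]].

(** The deep parts cancel, and the wide part is 48 times the difference of two wide classes that
    differ by exchanging 2 and 3 between the brackets. *)
Lemma wide_certificate :
  [&& perm_words wide_words, cancels 7 (contribution false wide_words)
    & cancels 7 (contribution true wide_words ++
        [seq (- t.1, sort_word true t.2)
        | t <- [:: (48%:Z, id7); (- 48%:Z, [:: 0; 1; 3; 2; 4; 5; 6]%N)]])].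
Proof. by vm_compute. Qed.

(** The deep part is 216 times a single class. The relation is applied once the wide values are
    known to vanish, so only the deep part is computed. *)
Lemma deep_certificate :
  perm_words deep_words && cancels 7 (contribution false deep_words ++
    [seq (- t.1, sort_word false t.2) | t <- [:: (216%:Z, id7)]]).
Proof. by vm_compute. Qed.

(** * Uniqueness of the solutions *)

(** This carries a relation certified for the word 0, ..., 6 over to every other word. *)
Lemma planar_solution_tmap Y v : perm_eq v (iota 0 7) ->
  planar_solution Y -> planar_solution (Y \o tmap w[v]).
Proof.
move=> pv [symY eqY]; split=> [k t u h uP|w pw] /=.
  apply: symY (tequiv_tmap _ h) _.
  rewrite /multilinear tleaves_tmap (perm_trans (perm_map _ uP)) //.
  by rewrite tmap_nth_iota // (perm_size pv).
rewrite -[RHS](eqY _ (perm_relabel pv pw)).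
apply: eq_big_seq => p /planar7_leaves lp; rewrite tmap_comp; congr Y.
apply: eq_in_tmap => i; rewrite lp mem_iota => i7 /=.
by rewrite (nth_map 0%N) // (perm_size pw).
Qed.

Lemma on_words_tmap Y v b w : size w = 7%N ->
  on_words (Y \o tmap w[v]) b w = on_words Y b (map w[v] w).
Proof. by move=> sz; rewrite /on_words /= tmap_nth_class_tree. Qed.

(** Adjacent transpositions generate all permutations: a letter is moved to the front step by step,
    and induction treats the rest. *)
Lemma adjacent_perm_invariant (T : eqType) (V : Type) (g : seq T -> V) :
  (forall u a b v, g (u ++ [:: a, b & v]) = g (u ++ [:: b, a & v])) ->
  forall s t, perm_eq s t -> g s = g t.
Proof.
move=> gS.
have gM p u a v : g (p ++ u ++ a :: v) = g (p ++ a :: u ++ v).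
  elim: u p => [|b u IH] p //=.
  by rewrite -cat_rcons IH cat_rcons gS.
suff gP p s t : perm_eq s t -> g (p ++ s) = g (p ++ t) by move=> s t; apply: (gP [::]).
elim: s t p => [|a s IH] t p; first by rewrite perm_sym => /perm_nilP ->.
move=> st; have at_ : a \in t by rewrite -(perm_mem st) mem_head.
case/splitPr: at_ st => u v.
have e : perm_eq (u ++ a :: v) (a :: u ++ v) by rewrite (perm_catCA u [:: a] v).
rewrite (permPr e) perm_cons => st.
by rewrite gM -!(cat_rcons a); apply: IH.
Qed.

(* The representative of the wide classes whose lone leaf is j. *)
Definition lone_word (j : nat) : seq nat := rcons (rem j (iota 0 7)) j.

Lemma lone_word_perm j : (j < 7)%N -> perm_eq (lone_word j) (iota 0 7).
Proof.
move=> j7; rewrite /lone_word perm_rcons perm_sym.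
by apply: perm_to_rem; rewrite mem_iota.
Qed.

Section Uniqueness.
Variable Y : tmon -> rat.
Hypothesis solY : planar_solution Y.

Lemma wide_middle_swap a b c d e f g :
  perm_eq [:: a; b; c; d; e; f; g] (iota 0 7) ->
  on_words Y true [:: a; b; c; d; e; f; g] = on_words Y true [:: a; b; d; c; e; f; g].
Proof.
move=> pv; have solY' := planar_solution_tmap pv solY.
have /and3P[pw c1 c2] := wide_certificate.
have := contribution_cancels solY'
  (tgt := [:: (48%:Z, id7); (- 48%:Z, [:: 0; 1; 3; 2; 4; 5; 6]%N)]) pw isT c2.
have Z1 := contribution_cancels solY' (b := false) (tgt := [::]) pw isT.
rewrite cats0 in Z1; move: (Z1 c1); rewrite big_nil => {Z1}.
rewrite !(contribution_sum solY' _ pw) => Z0.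
(* In each equation the wide sum is the negative of the deep sum, and the combined deep sums vanish
   by [Z0]. *)
have -> : \sum_(w <- wide_words) w.1%:~R * (\sum_(s <- patterns true)
    on_words (Y \o tmap w[[:: a; b; c; d; e; f; g]]) true (map w[w.2] s)) = 0.
  apply: oppr_inj; rewrite oppr0 [RHS]Z0 -sumrN; apply: eq_big_seq => w /(allP pw) pw'.
  rewrite -mulrN; congr (_ * _); apply/eqP.
  by rewrite eqr_oppLR -addr_eq0 (on_words_equation solY').
rewrite big_cons big_seq1 /fst /snd intrN mulNr => /eqP.
rewrite -mulrBr mulf_eq0 intr_eq0 orFb subr_eq0 => /eqP.
by rewrite (on_words_tmap Y) // (on_words_tmap Y).
Qed.

Lemma wide_lone j s t : perm_eq s t -> perm_eq (rcons s j) (iota 0 7) ->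
  on_words Y true (rcons s j) = on_words Y true (rcons t j).
Proof.
move=> st ps.
(* The value 0 off the permutations makes invariance under adjacent swaps meaningful for arbitrary
   words. *)
pose g s := if perm_eq (rcons s j) (iota 0 7) then on_words Y true (rcons s j) else 0.
have gS u a b v : g (u ++ [:: a, b & v]) = g (u ++ [:: b, a & v]).
  have pab : perm_eq (rcons (u ++ [:: a, b & v]) j) (rcons (u ++ [:: b, a & v]) j).
    by rewrite -!cats1 perm_cat2r perm_cat2l (perm_catCA [:: a] [:: b] v).
  rewrite /g (permPl pab); case: ifP => // pw; have sz := perm_size pw.
  have pw' := perm_trans pab pw.
  have r i := tequiv_refl (TVar i).
  have r3 a1 b1 c1 := tequiv_refl (TProd (TVar a1) (TVar b1) (TVar c1)).
  have M := multilinear_class_tree true pw.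
  rewrite size_rcons size_cat /= !addnS in sz; case: sz => sz.
  (* Of the five positions of the swap, four lie inside a bracket and are symmetries of the tree;
     the one across the two brackets is [wide_middle_swap]. *)
  case: u sz pw pw' M {pab} => [|u1 [|u2 [|u3 [|u4 [|]]]]] //=;
    case: v => [|v1 [|v2 [|v3 [|v4 [|]]]]] //= _ pw pw' M.
  - exact: (proj1 solY) (TeqProd (TeqSwap12 (r3 a b v1)) (r3 v2 v3 v4) (r j)) M.
  - exact: (proj1 solY) (TeqProd (TeqSwap23 (r3 u1 a b)) (r3 v1 v2 v3) (r j)) M.
  - exact: wide_middle_swap.
  - exact: (proj1 solY) (TeqProd (r3 u1 u2 u3) (TeqSwap12 (r3 a b v1)) (r j)) M.
  - exact: (proj1 solY) (TeqProd (r3 u1 u2 u3) (TeqSwap23 (r3 u4 a b)) (r j)) M.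
have := adjacent_perm_invariant gS st; rewrite /g ps.
by rewrite -(permPl (_ : perm_eq (rcons s j) (rcons t j))) ?ps // -!cats1 perm_cat2r.
Qed.

Hypothesis lone0 : forall j, (j < 7)%N -> on_words Y true (lone_word j) = 0.

Lemma wide_zero w : perm_eq w (iota 0 7) -> on_words Y true w = 0.
Proof.
case/lastP: w => [|s j] pw; first by have := perm_size pw.
have j7 : (j < 7)%N.
  by have := perm_mem pw j; rewrite mem_rcons mem_head mem_iota => /esym.
rewrite -(lone0 j7) /lone_word; apply: (wide_lone _ pw).
have := lone_word_perm j7; rewrite /lone_word perm_sym => /(perm_trans pw).
by rewrite -!cats1 perm_cat2r.
Qed.

Lemma deep_zero v : perm_eq v (iota 0 7) -> on_words Y false v = 0.
Proof.
move=> pv; have solY' := planar_solution_tmap pv solY.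
have /andP[pw c2] := deep_certificate.
have := contribution_cancels solY' (tgt := [:: (216%:Z, id7)]) pw isT c2.
rewrite (contribution_sum solY' _ pw) [X in _ = X]big1_seq => [|w /andP[_ /(allP pw) pw']].
  rewrite big_seq1 /fst /snd => /eqP; rewrite mulf_eq0 intr_eq0 orFb => /eqP.
  by rewrite (on_words_tmap Y) // tmap_nth_iota // (perm_size pv).
have := on_words_equation solY' pw'; rewrite [X in X + _]big1_seq.
  by rewrite add0r => ->; rewrite mulr0.
move=> s /patterns_perm ps; rewrite (on_words_tmap Y); last by rewrite size_map (perm_size ps).
exact/wide_zero/perm_relabel/perm_relabel.
Qed.

Lemma planar_solution_zero t : multilinear 7 t -> Y t = 0.
Proof.
move=> /exists_class_tree[w pw [k h]]; rewrite (proj1 solY _ _ _ h) ?multilinear_class_tree //.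
by case: is_wide; [exact: wide_zero|exact: deep_zero].
Qed.

End Uniqueness.

(** * The seven-dimensional family of solutions *)

(** Leaf depths describe the solutions without reference to the order of children. In [[[abc]de]fg]
    the leaves a, b, c have depth 3, d, e depth 2 and f, g depth 1; in the wide shape g alone has
    depth 1. *)
Fixpoint depth_sum (h : nat -> rat) (d : nat) (t : tmon) : rat :=
  match t, d with
  | TVar i, 0 => h i
  | TProd x y z, d'.+1 => depth_sum h d' x + depth_sum h d' y + depth_sum h d' z
  | _, _ => 0
  end.

Definition weight (h : nat -> rat) (t : tmon) : rat :=
  if is_wide t then depth_sum h 1 t
  else (2 * depth_sum h 2 t - depth_sum h 1 t - depth_sum h 3 t) / 3.

Lemma tequiv_weight h k t u : tequiv k t u -> weight h t = weight h u.
Proof.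
move=> e; have [hE dE] : height t = height u /\ forall d, depth_sum h d t = depth_sum h d u.
  elim: e => {k t u} [i|k1 k2 k3 t1 t2 t3 u1 u2 u3 _ [h1 d1] _ [h2 d2] _ [h3 d3]
    |k t u1 u2 u3 _ [hE dE]|k t u1 u2 u3 _ [hE dE]] //=.
  - by rewrite h1 h2 h3; split=> // -[|d] //=; rewrite d1 d2 d3.
  - rewrite hE /= maxnCA; split=> // -[|d]; rewrite dE //=; ring.
  - rewrite hE /= (maxnC (height u2)); split=> // -[|d]; rewrite dE //=; ring.
by rewrite /weight /is_wide hE !dE.
Qed.

Lemma weight_planar7 h r : \sum_(p <- planar7) weight h (tmap r p) = 0.
Proof.
let s := eval vm_compute in planar7 in have -> : planar7 = s by vm_compute.
rewrite !big_cons big_nil /weight /=; lra.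
Qed.

Lemma weight_lone h j : (j < 7)%N -> weight h (tmap w[lone_word j] (class_tree true)) = h j.
Proof.
move=> j7; rewrite /weight /is_wide height_tmap /=.
rewrite nth_rcons size_rem ?mem_iota //= !add0r; ring.
Qed.

(** The children along the path to c are moved to the front. Hence every alternating class contains
    a monomial with any prescribed center. *)
Lemma center_rotate u c : c \in tleaves u -> exists t k, tequiv k t u /\ center t = c.
Proof.
elim: u => [i|u1 IH1 u2 IH2 u3 IH3] /=.
  by rewrite inE => /eqP ->; exists (TVar i), 1; split; first exact: TeqVar.
rewrite !mem_cat => /or3P[/IH1|/IH2|/IH3] [t [k [h <-]]].
- exists (TProd t u2 u3); eexists; split=> //.
  exact: TeqProd h (tequiv_refl u2) (tequiv_refl u3).
- exists (TProd t u1 u3); eexists; split=> //.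
  exact: TeqSwap12 (TeqProd h (tequiv_refl u1) (tequiv_refl u3)).
- exists (TProd t u1 u2); eexists; split=> //.
  exact: TeqSwap23 (TeqSwap12 (TeqProd h (tequiv_refl u1) (tequiv_refl u2))).
Qed.

(** A single monomial in each class of given center carries a coefficient, so the coordinates can be
    prescribed freely; the factor [wsgn] undoes the twist. *)
Definition weight_poly (g : nat -> nat -> rat) : mlpoly 7 :=
  [ffun m => if rep m == m then wsgn (tleaves m) * weight (g (center m)) m else 0].

Lemma phi_weight_poly g c (u : mlmon 7) : (c < 7)%N ->
  phi (weight_poly g) c u = wsgn (tleaves u) * weight (g c) u.
Proof.
move=> c7; have cu : c \in tleaves u by rewrite (perm_mem (valP u)) mem_iota.
have [t [k [h ct]]] := center_rotate cu.
have tP : multilinear 7 t by rewrite /multilinear (permPl (tequiv_perm h)); exact: (valP u).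
pose m0 := MlMon tP; pose r := rep m0.
have class_of m m' : acoef m u != 0 -> acoef m' u != 0 -> acoef m m' != 0.
  move=> /(acoef_tequiv (mlmon_uniq u)) e; rewrite (tequiv_acoefl _ e) acoef_sym.
  by move=> e'; rewrite mulf_neq0 // ?(tequiv_neq0 e).
have a0 : acoef m0 u != 0.
  by rewrite (tequiv_acoefl _ h) acoef_refl ?mlmon_uniq // mulr1 (tequiv_neq0 h).
have /andP[/eqP cr ar] := same_class_rep m0; rewrite -/r in cr ar.
have aru : acoef r u != 0.
  have e := acoef_tequiv (mlmon_uniq r) ar; move: a0.
  by rewrite (tequiv_acoefl _ e) mulf_eq0 negb_or => /andP[].
have crc : center r = c by rewrite cr.
(* Only the representative [r] with center c in the class of u contributes. Its sign relative to u
   enters once through [acoef] and once through [wsgn], and so cancels. *)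
rewrite /phi (bigD1 r) ?crc ?eqxx //= big1 ?addr0 => [|m /andP[/eqP cm mr]].
  rewrite ffunE /r rep_id eqxx -/r crc.
  have e := acoef_tequiv (mlmon_uniq u) aru.
  rewrite (tequiv_wsgn e (mlmon_uniq u)) (tequiv_weight _ e).
  have kk := tequiv_sq e; set k' := acoef r u in kk *.
  have -> : k' * wsgn (tleaves u) * weight (g c) u * k' =
    (k' * k') * (wsgn (tleaves u) * weight (g c) u) by ring.
  by rewrite kk mul1r.
rewrite ffunE; case: eqP => rm; last by rewrite mul0r.
have [->|amu] := eqVneq (acoef m u) 0; first by rewrite mulr0.
have mr' : same_class m r by rewrite /same_class crc cm eqxx class_of.
by case/eqP: mr; rewrite -rm (rep_eq mr') /r rep_id.
Qed.

(** * Linear maps and the dimension count *)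

Lemma phi_linear n c u : linear (fun f : mlpoly n => phi f c u : rat^o).
Proof.
move=> k f g; rewrite /phi scaler_sumr -big_split; apply: eq_bigr => m _ /=.
by rewrite !ffunE mulrDl /GRing.scale /= mulrA.
Qed.

Lemma phi_tequiv n (f : mlpoly n) c k t u : tequiv k t u -> phi f c t = k * phi f c u.
Proof.
move=> h; rewrite /phi mulr_sumr; apply: eq_bigr => m _.
by rewrite (tequiv_acoefr _ h) mulrCA.
Qed.

(** Bundling the functionals into one map makes their common zeros a kernel. *)
Lemma hom_of_functionals n (I : finType) (L : I -> mlpoly n -> rat^o) :
  (forall i, linear (L i)) ->
  exists h : 'Hom(mlpoly n, {ffun I -> rat^o}), forall f i, h f i = L i f.
Proof.
move=> L_lin; pose F (f : mlpoly n) : {ffun I -> rat^o} := [ffun i => L i f].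
have F_lin : linear F by move=> k f g; apply/ffunP=> i; rewrite !ffunE L_lin.
pose F' : {linear mlpoly n -> {ffun I -> rat^o}} :=
  HB.pack F (GRing.isLinear.Build _ _ _ _ F F_lin).
by exists (linfun F') => f i; rewrite lfunE /= ffunE.
Qed.

(** The sign of an equivalence occurs in both factors and squares to 1. In an equation all trees
    have leaf word w, so the twist is a common factor. *)
Lemma phi_planar_solution (f : mlpoly 7) c :
  (forall w, perm_eq w (iota 0 7) ->
     \sum_(p : mlmon 7 | tleaves p == w) phi f c p = 0) ->
  planar_solution (fun t => wsgn (tleaves t) * phi f c t).
Proof.
move=> Hf; split=> [k t u h uP|w pw].
  have uu : uniq (tleaves u) by rewrite (perm_uniq uP) iota_uniq.
  rewrite (phi_tequiv _ _ h) (tequiv_wsgn h uu).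
  by rewrite mulrACA (tequiv_sq h) mul1r.
transitivity (wsgn w * \sum_(p <- planar7) phi f c (tmap w[w] p)); last first.
  by rewrite -planar7_sum // Hf // mulr0.
rewrite mulr_sumr; apply: eq_big_seq => p /planar7_leaves lp.
by rewrite tleaves_tmap lp tmap_nth_iota // (perm_size pw).
Qed.

(* The quotient of V_PATS by its subspace V_PQ is represented by the
   complement V_PATS :\: V_PQ of V_PQ in V_PATS. *)
Theorem mainTheorem4 :
  exists V_PATS V_PQ : {vspace mlpoly 7},
    [/\ forall f : mlpoly 7, f \in V_PATS <-> satisfied_by_PATS f,
        forall f : mlpoly 7, f \in V_PQ <-> consequence_of_PQ f,
        (V_PQ <= V_PATS)%VS
      & \dim (V_PATS :\: V_PQ) = 49%N].
Proof.
have [hPhi PhiE] := hom_of_functionals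
  (fun i : 'I_7 * mlmon 7 => @phi_linear 7 i.1 i.2).
have Psi_lin (i : 'I_7 * mlmon 7) : linear (fun f : mlpoly 7 =>
    \sum_(p : mlmon 7 | tleaves p == tleaves i.2) phi f i.1 p : rat^o).
  move=> k f g; rewrite scaler_sumr -big_split; apply: eq_bigr => p _.
  exact: phi_linear.
have [hPsi PsiE] := hom_of_functionals Psi_lin.
pose sgn_lone (j : 'I_7) := wsgn (lone_word j).
pose lone_tree (j : 'I_7) := tmap w[lone_word j] (class_tree true).
(* For each center, these are the twisted values at the wide classes with lone leaf j, that is, the
   seven parameters h. *)
have Pi_lin (i : 'I_7 * 'I_7) : linear (fun f : mlpoly 7 =>
    sgn_lone i.2 * phi f i.1 (lone_tree i.2) : rat^o).
  move=> k f g; rewrite phi_linear mulrDr; congr (_ + _).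
  by rewrite /GRing.scale /= mulrCA.
have [hPi PiE] := hom_of_functionals Pi_lin.
have inPhi f : f \in lker hPhi <-> forall (c : 'I_7) (u : mlmon 7), phi f c u = 0.
  rewrite memv_ker; split=> [/eqP f0 c u|f0].
    by have := PhiE f (c, u); rewrite f0 ffunE.
  by apply/eqP/ffunP => i; rewrite PhiE f0 ffunE.
have inPsi f : f \in lker hPsi <-> forall (c : 'I_7) w, perm_eq w (iota 0 7) ->
    \sum_(p : mlmon 7 | tleaves p == w) phi f c p = 0.
  rewrite memv_ker; split=> [/eqP f0 c w pw|f0].
    (* Each permutation w is the leaf word of some monomial, so functionals indexed by monomials
       cover all words. *)
    pose q := MlMon (multilinear_class_tree true pw).
    have lq : tleaves q = w by rewrite tleaves_nth_class_tree // (perm_size pw).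
    by have := PsiE f (c, q); rewrite f0 ffunE /fst /snd lq.
  by apply/eqP/ffunP => i; rewrite PsiE f0 ?ffunE //; exact: (valP i.2).
have sub : (lker hPhi <= lker hPsi)%VS.
  by apply/subvP => f /inPhi f0; apply/inPsi => c w _; rewrite big1.
exists (lker hPsi), (lker hPhi); split=> //.
- by move=> f; rewrite inPsi satisfied_by_PATS_phi.
- move=> f; rewrite inPhi; split=> [f0|/consequence_phi f0 c u]; last exact: f0.
  apply: phi_consequence => u.
  have c7 : (center u < 7)%N.
    by have := center_leaves u; rewrite (perm_mem (valP u)) mem_iota.
  exact: (f0 (Ordinal c7)).
have lone_ml (j : 'I_7) : multilinear 7 (lone_tree j).
  exact/multilinear_class_tree/lone_word_perm.
have lone_leaves (j : 'I_7) : tleaves (lone_tree j) = lone_word j.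
  by rewrite tleaves_nth_class_tree // (perm_size (lone_word_perm (ltn_ord j))).
(* Uniqueness: in V_PATS the 49 parameters determine all coordinates. *)
have kerPi : (lker hPsi :&: lker hPi)%VS = (lker hPsi :&: lker hPhi)%VS.
  apply/vspaceP => f; rewrite !memv_cap; case fPsi: (f \in lker hPsi) => //=.
  apply/idP/idP => [|/inPhi f0]; last first.
    rewrite memv_ker; apply/eqP/ffunP => i.
    by rewrite PiE ffunE (f0 i.1 (MlMon (lone_ml i.2))) mulr0.
  rewrite memv_ker => /eqP f0; apply/inPhi => c u.
  have /inPsi/(_ c)/phi_planar_solution solY := fPsi.
  have := planar_solution_zero solY _ (valP u).
  move=> H; have /eqP : wsgn (tleaves u) * phi f c u = 0.
    apply: H => j j7; set i := Ordinal j7.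
    change (wsgn (tleaves (lone_tree i)) * phi f c (lone_tree i) = 0).
    rewrite lone_leaves.
    by have := PiE f (c, i); rewrite f0 ffunE => /esym.
  rewrite mulf_eq0 => /orP[/eqP w0|/eqP //].
  by have := wsgn_sq (tleaves u); rewrite w0 mul0r => /eqP; rewrite eq_sym oner_eq0.
(* Existence: the weights realize every choice of the 49 parameters inside V_PATS. *)
have imPi : (hPi @: lker hPsi)%VS = fullv.
  apply/eqP; rewrite eqEsubv subvf; apply/subvP => g _; apply/memv_imgP.
  pose g' (c j : nat) : rat := g (inord c, inord j).
  exists (weight_poly g').
    apply/inPsi => c w pw.
    transitivity (wsgn w * \sum_(p : mlmon 7 | tleaves p == w) weight (g' c) p).
      rewrite mulr_sumr; apply: eq_bigr => p /eqP <-.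
      by rewrite phi_weight_poly.
    by rewrite (planar7_sum _ pw) weight_planar7 mulr0.
  apply/ffunP => -[c j]; rewrite PiE /fst /snd.
  have -> : phi (weight_poly g') c (lone_tree j) =
      wsgn (tleaves (lone_tree j)) * weight (g' c) (lone_tree j).
    exact: (phi_weight_poly g' (MlMon (lone_ml j)) (ltn_ord c)).
  rewrite lone_leaves weight_lone // mulrA wsgn_sq mul1r.
  by rewrite /g' !inord_val.
(* By rank and nullity of [hPi] on V_PATS, the complement of V_PQ has the dimension of the image, 7
   centers times 7 parameters. *)
have := limg_ker_dim hPi (lker hPsi).
rewrite -(dimv_cap_compl (lker hPsi) (lker hPhi)) kerPi => /addnI <-.
rewrite imPi dimvf.
change ((#|{: 'I_7 * 'I_7}| * 1)%N = 49%N).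
by rewrite card_prod card_ord.
Qed.
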